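(* Let $G:\mathbb{R}\to\mathbb{R}$ be a translation-invariant covariance function with spectral density $\widehat{G}$ of the form $\widehat{G}(t)=e^{-S(|t|)}=e^{-T(\ln|t|)}$, where $S\in C^2(\mathbb{R}_+)$, $T\in C^2(\mathbb{R})$, and suppose that $S'(t)\ge 0$ and $S''(t)\ge 0$ for all $t>0$, and $S'(t)\to+\infty$ as $t\to+\infty$. Consider the optimization problem $f(x)\to\min_{x\in[-1,1]}$ with the objective function $f=-G$ on $[-1,1]$. Let $\{x_k\}_{k=1}^\infty$ be a trajectory of the Expected Improvement optimization of $f$ with the kernel $G$, starting from $x_1=0$ (the point where the minimum of $f$ is already attained). Then $x_k\to 0$ as $k\to\infty$; in particular the trajectory is not dense in $[-1,1]$. Moreover, for all sufficiently large $K$, $$e^{2^K F(K)}\le |x_{K+1}|\le e^{F(K)/3},$$ where $F(K)=T^*(2K+1)-(2K+1)\ln K$ and $T^*(q)=\max_{s\in\mathbb{R}}(qs-T(s))$ is the Legendre transform of $T$ (finite for all sufficiently large $q$).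
   Context: Spectral density: $G(x)=\int_{\mathbb{R}}\widehat{G}(t)e^{itx}\,dt$ and $\widehat{G}(t)=\frac{1}{2\pi}\int_{\mathbb{R}}G(x)e^{-itx}\,dx$. The kernel $G(x,y)=G(x-y)$ is the covariance $\mathsf{E}(\xi_x\xi_y)$ of a centered stationary real Gaussian process $(\xi_x)_{x\in[-1,1]}$; since $\widehat{G}>0$, the kernel is strictly positive definite. Expected Improvement (EI) optimization of $f:[-1,1]\to\mathbb{R}$ with kernel $G$: given distinct points $x_1,\dots,x_K\in[-1,1]$, put $f_K^*=\min_{k\le K}f(x_k)$ and $$m_K(x)=\mathbf g_{K,x}^t\mathbf G_K^{-1}\mathbf f_K,\qquad \sigma^2_{x;\{x_k\}_{k=1}^K}=G(0)-\mathbf g_{K,x}^t\mathbf G_K^{-1}\mathbf g_{K,x},$$ where $\mathbf f_K=(f(x_1),\dots,f(x_K))^t$, $\mathbf g_{K,x}=(G(x-x_1),\dots,G(x-x_K))^t$, $\mathbf G_K=(G(x_k-x_l))_{k,l=1}^K$. These are the mean and variance of $\xi_x$ conditioned on $\xi_{x_k}=f(x_k)$, $k=1,\dots,K$. The expected improvement is $$I_K(x)=\mathsf{E}\big(f_K^*-\min(f_K^*,\xi_x)\,\big|\,\xi_{x_k}=f(x_k),\ k=1,\dots,K\big)=\mathsf{E}\big(f_K^*-\min(f_K^*,Z)\big),\quad Z\sim\mathcal N\big(m_K(x),\sigma^2_{x;\{x_k\}_{k=1}^K}\big).$$ The next point $x_{K+1}$ is a maximizer of $I_K$ over $[-1,1]$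 (the maximum exists; if there are several maximizers any of them may be taken). Starting from a given $x_1$, this produces a trajectory $\{x_k\}_{k=1}^\infty$, whose points are all different. *)

(* Defs.v *)
From HB Require Import structures.
From mathcomp Require Import all_boot all_order all_algebra.
From mathcomp Require Import all_classical all_reals all_analysis.

Set Implicit Arguments.
Unset Strict Implicit.
Unset Printing Implicit Defensive.

Import Order.TTheory GRing.Theory Num.Theory.
Import numFieldNormedType.Exports.

Local Open Scope classical_set_scope.
Local Open Scope ring_scope.

(* Meant for open [A]: at interior points of [A], [g^`()] only involves the
   values of [g] on [A]. *)
Definition C2_on (R : realType) (A : set R) (g : R -> R) : Prop :=
  forall t, A t ->
    [/\ derivable g t 1, derivable g^`()%classic t 1 & {for t, continuous g^`(2)%classic}].

(* [normal_prob m s] takes the standard deviation [s] and is a placeholder law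
   when [s = 0], so the degenerate case is given separately as a point mass. *)
Definition gauss_law (R : realType) (m v : R) :
    probability (measurableTypeR R) R :=
  if v == 0 then (\d_(m : measurableTypeR R) : probability (measurableTypeR R) R)
  else (normal_prob m (Num.sqrt v) : probability (measurableTypeR R) R).

(* [G (x - y)] is the covariance of a centered jointly Gaussian process indexed
   by [A]; joint Gaussianity means that all finite linear combinations are
   (possibly degenerate) Gaussian.  Stationarity is that the covariance depends
   on [x - y] only. *)
Definition stationary_gaussian_covariance (R : realType) (A : set R)
    (G : R -> R) : Prop :=
  exists (d : measure_display) (Omega : measurableType d)
         (P : probability Omega R) (xi : R -> {RV P >-> R}),
    [/\ forall x, A x -> ('E_P[xi x] = 0)%E,
        forall x y, A x -> A y -> ('E_P[(xi x \* xi y)%R] = (G (x - y))%:E)%E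
      & forall (n : nat) (p c : 'I_n -> R), (forall i, A (p i)) ->
          exists v : R, 0 <= v /\
            forall B : set R, measurable B ->
              P [set w | B (\sum_(i < n) c i * xi (p i) w)] = gauss_law 0 v B].

(* [G x] is the integral of [Ghat t * exp(i t x)]; as [G] is real-valued this
   is the pair of equations for the real and imaginary parts. *)
Definition has_spectral_density (R : realType) (G Ghat : R -> R) : Prop :=
  lebesgue_measure.-integrable [set: R] (EFin \o Ghat) /\
  forall x, G x = \int[lebesgue_measure]_t (Ghat t * cos (t * x)) /\
            0 = \int[lebesgue_measure]_t (Ghat t * sin (t * x)).

(* Sequences of points are numbered from 1: for [x : nat -> R] the first [K]
   points are [x 1], ..., [x K], and [x 0] is never used. *)
Section ExpectedImprovement.
Context {R : realType}.
Implicit Types (G f : R -> R) (x : nat -> R) (K : nat) (y : R).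

Definition gram G x K : 'M[R]_K := \matrix_(k, l) G (x k.+1 - x l.+1).

Definition kernel_vec G x K y : 'cV[R]_K := \col_k G (y - x k.+1).

Definition value_vec f x K : 'cV[R]_K := \col_k f (x k.+1).

Definition cond_mean G f x K y : R :=
  ((kernel_vec G x K y)^T *m invmx (gram G x K) *m value_vec f x K) 0 0.

Definition cond_var G x K y : R :=
  G 0 -
  ((kernel_vec G x K y)^T *m invmx (gram G x K) *m kernel_vec G x K y) 0 0.

(* The minimum of [f] over the first [K] points, for [0 < K]. *)
Definition best_value f x K : R :=
  \big[Num.min/f (x 1%N)]_(k < K) f (x k.+1).

Definition expected_improvement G f x K y : R :=
  \int[gauss_law (cond_mean G f x K y) (cond_var G x K y)]_z
    (best_value f x K - Num.min (best_value f x K) z).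

(* Distinctness of the points is not required separately: it follows from the
   maximization when the kernel is strictly positive definite. *)
Definition EI_trajectory G f x : Prop :=
  x 1%N \in `[-1, 1] /\
  forall K, (0 < K)%N ->
    x K.+1 \in `[-1, 1] /\
    forall y, y \in `[-1, 1] ->
      expected_improvement G f x K y <= expected_improvement G f x K (x K.+1).

End ExpectedImprovement.

(* Only meaningful where the set is bounded above; it is a maximum when
   [legendre_attained] holds. *)
Definition legendre (R : realType) (T : R -> R) (q : R) : R :=
  sup (range (fun s => q * s - T s)).

Definition legendre_attained (R : realType) (T : R -> R) (q : R) : Prop :=
  exists s, legendre T q = q * s - T s /\
    forall s', q * s' - T s' <= legendre T q.

Definition EI_rate (R : realType) (T : R -> R) (K : nat) : R :=
  legendre T (2 * K + 1)%:R - (2 * K + 1)%:R * ln K%:R.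

(* Main.v *)
Require Import Defs.
From HB Require Import structures.
From mathcomp Require Import all_boot all_order all_algebra.
From mathcomp Require Import all_classical all_reals all_analysis.
From mathcomp Require Import measurable_realfun.
From mathcomp Require Import ring lra.
Set Implicit Arguments.
Unset Strict Implicit.
Unset Printing Implicit Defensive.
Import Order.TTheory GRing.Theory Num.Theory.
Import numFieldNormedType.Exports.
Local Open Scope classical_set_scope.
Local Open Scope ring_scope.

(** Why the optimization gets stuck at the minimum it already knows.

Because [x 1 = 0] and [f = - G], the vector of observed values is minus the
first column of the Gram matrix, so the conditional mean is [- G] exactly
([cond_meanE]).  The expected improvement at [y] is therefore the mean of
[(s N - d)_+], where [N] is a standard normal variable, [s] is the conditional
standard deviation at [y] and [d = G 0 - G y], which lies between two multiples
of [y ^+ 2].  It is at most [2 s expR (- d^2 / (4 s^2))], and it is at least a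
multiple of [s] as soon as [d <= s].

Everything then depends on two estimates of [s] by the product of the distances
from [y] to the nodes.  The conditional variance is the minimum over [c] of
[\int Ghat |e^(ity) - \sum_k c_k e^(it x_k)|^2 dt].

- Upper bound ([spectral_form_le]).  With Lagrange weights the modulus is the
  product of the distances times a divided difference of [e^(it.)], which is at
  most [|t|^K / K!]; this leaves the moment [\int t^(2K) Ghat].  Convexity of [S]
  makes [t^(2K) Ghat(t)] decay exponentially on the scale of the point where
  [t^(2K+1) Ghat(t)] is maximal, so the moment is at most [2 e] times that
  maximum, that is [2 e expR (T^*(2K+1))].
- Lower bound ([spectral_form_ge]).  On [[-1, 1]] the density is bounded below,
  and [K] finite differences in [t] with step of order [1/K] remove the nodes one
  by one; each costs a constant factor in [L^2], so the loss is only
  [(4 K)^(2K)].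

Since [S' --> +oo], [EI_rate T K] is eventually below every [- B K]
([EI_rate_superlinear]).  Testing the maximality of [x_(K+1)] at a point [eta_K]
proportional to [\prod_(2 <= k <= K) |x_k|] yields
[|x_(K+1)| >= expR (- L K^2) \prod_(2 <= k <= K) |x_k|], whence
[|x_(K+1)| >= expR (- D 2^K)] with a constant [D] ([trajectory_ge]); this also
keeps all the nodes distinct.  Conversely the improvement at [x_(K+1)] is not
smaller than the improvement at [eta_K], whose logarithm is at least of order
[- 2^K]; as [d^2 / s^2] is at least of order
[x_(K+1)^2 K!^2 expR (- T^*(2K+1)) 4^(-K)], this bounds [x_(K+1)^2] by
[expR (EI_rate T K + O(K))] ([trajectory_le]).  A rate more negative than any
multiple of [K] absorbs both the [O(K)] and the constant [D]. *)

(** * Exponential sums and their lower bound in mean square *)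

Section ExponentialSums.
Context {R : realType} {I : eqType}.
Implicit Types (s : seq I) (c p : I -> R) (t h z : R).

Definition cos_sum s c p t : R := \sum_(j <- s) c j * cos (t * p j).
Definition sin_sum s c p t : R := \sum_(j <- s) c j * sin (t * p j).
(** The squared modulus of [\sum_j c_j e^(i t p_j)] for real [c]. *)
Definition exp_sum_sqr s c p t : R :=
  cos_sum s c p t ^+ 2 + sin_sum s c p t ^+ 2.

Lemma exp_sum_sqr_ge0 s c p t : 0 <= exp_sum_sqr s c p t.
Proof. by rewrite addr_ge0 ?sqr_ge0. Qed.

Lemma continuous_exp_sum_sqr s c p : continuous (exp_sum_sqr s c p).
Proof.
have cc (g : R -> R) : continuous g ->
    continuous (fun t => \sum_(j <- s) c j * g (t * p j)).
  move=> cg; elim: s => [|j s IH] t.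
    rewrite (_ : (fun _ => _) = cst 0); first exact: cvg_cst.
    by apply/funext => u; rewrite big_nil.
  rewrite (_ : (fun _ => _) = (fun u => c j * g (u * p j)) \+
     (fun u => \sum_(j <- s) c j * g (u * p j))); last first.
    by apply/funext => u; rewrite big_cons.
  apply: continuousD; last exact: IH.
  apply: continuousM; first exact: cvg_cst.
  apply: (@continuous_comp R R R (fun u : R => u * p j) g); last exact: cg.
  by apply: continuousM; [exact: cvg_id | exact: cvg_cst].
have csqr (g : R -> R) : continuous g -> continuous (fun t => g t ^+ 2).
  by move=> cg t; apply: (@continuous_comp R R R g (fun x : R => x ^+ 2));
    [exact: cg | exact: exprn_continuous].
move=> t; exact: (continuousD (csqr _ (cc _ (@continuous_cos R)) t)
                              (csqr _ (cc _ (@continuous_sin R)) t)).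
Qed.

(** [e^(-ihz) P(t+h) - e^(ihz) P(t-h) = 2i \sum_j c_j sin (h (p_j - z)) e^(i t p_j)]:
this symmetric difference keeps the coefficients real and kills the frequency [z].
The estimate is the parallelogram law. *)
Lemma exp_sum_sqr_difference s c p t h z :
  exp_sum_sqr s (fun j => 2 * c j * sin (h * (p j - z))) p t <=
  2 * exp_sum_sqr s c p (t + h) + 2 * exp_sum_sqr s c p (t - h).
Proof.
set C1 := cos_sum s c p (t + h); set C0 := cos_sum s c p (t - h).
set S1 := sin_sum s c p (t + h); set S0 := sin_sum s c p (t - h).
set a := cos (h * z); set b := sin (h * z).
have ->: exp_sum_sqr s (fun j => 2 * c j * sin (h * (p j - z))) p t =
    (a * (S1 - S0) - b * (C1 + C0)) ^+ 2 +
    (a * (C0 - C1) - b * (S1 + S0)) ^+ 2.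
  congr (_ ^+ 2 + _ ^+ 2).
    rewrite /C1 /C0 /S1 /S0 /cos_sum /sin_sum -sumrB -big_split/= !mulr_sumr -sumrB.
    apply: eq_bigr => j _; rewrite [(t + h) * _]mulrDl [(t - h) * _]mulrBl [h * (_ - _)]mulrBr.
    rewrite !(cosD, sinD, cosN, sinN) -/a -/b.
    by ring.
  rewrite /C1 /C0 /S1 /S0 /cos_sum /sin_sum -sumrB -big_split/= !mulr_sumr -sumrB.
  apply: eq_bigr => j _; rewrite [(t + h) * _]mulrDl [(t - h) * _]mulrBl [h * (_ - _)]mulrBr.
    rewrite !(cosD, sinD, cosN, sinN) -/a -/b.
  by ring.
rewrite /exp_sum_sqr -/C1 -/C0 -/S1 -/S0.
have ab : a ^+ 2 + b ^+ 2 = 1 by rewrite cos2Dsin2.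
rewrite -subr_ge0.
rewrite (_ : _ - _ = (a * (S1 + S0) - b * (C1 - C0)) ^+ 2 +
    (a * (C0 + C1) + b * (S1 - S0)) ^+ 2); first by rewrite addr_ge0 ?sqr_ge0.
have -> : 2 * (C1 ^+ 2 + S1 ^+ 2) + 2 * (C0 ^+ 2 + S0 ^+ 2) =
  (a ^+ 2 + b ^+ 2) * (2 * (C1 ^+ 2 + S1 ^+ 2) + 2 * (C0 ^+ 2 + S0 ^+ 2)).
  by rewrite ab mul1r.
by ring.
Qed.

End ExponentialSums.

Section Shift.
Context {R : realType}.
Local Notation mu := (@lebesgue_measure R).

Lemma integral_itv_shift (f : R -> R) (a b h : R) : a <= b -> continuous f ->
  (\int[mu]_(x in `[a, b]) (f (x + h))%:E = \int[mu]_(x in `[(a + h)%R, (b + h)%R]) (f x)%:E)%E.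
Proof.
move=> ab cf.
have d1 : (fun x : R => x + h)^`()%classic = cst 1.
  by apply/funext => x; rewrite derive1E deriveD// derive_id derive_cst addr0.
rewrite (@integration_by_substitution_increasing R (fun x => x + h) f a b)//.
- by apply: eq_integral => x _; rewrite d1 /= mulr1.
- by move=> x y _ _; rewrite ltrD2r.
- by rewrite d1 => x _; exact: cvg_cst.
- by rewrite d1; exact: is_cvg_cst.
- by rewrite d1; exact: is_cvg_cst.
- split => //.
  + by apply: cvg_at_right_filter; apply: cvgD; [exact: cvg_id|exact: cvg_cst].
  + by apply: cvg_at_left_filter; apply: cvgD; [exact: cvg_id|exact: cvg_cst].
- by apply: continuous_subspaceT.
Qed.

Lemma le_integral_itv_shift (f : R -> R) (a h e : R) : 0 <= a ->
  continuous f -> (forall x, 0 <= f x) -> `|h| <= e ->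
  (\int[mu]_(x in `[(- a)%R, a]) (f (x + h))%:E <=
   \int[mu]_(x in `[(- (a + e))%R, (a + e)%R]) (f x)%:E)%E.
Proof.
move=> a0 cf f0; rewrite ler_norml => /andP[eh he].
have aa : - a <= a by lra.
rewrite integral_itv_shift//.
apply: ge0_subset_integral => //=.
- apply/measurable_EFinP; apply: measurable_funTS.
  exact: continuous_measurable_fun.
- by move=> x _; rewrite lee_fin.
- by apply: subset_itv; rewrite bnd_simp; lra.
Qed.

End Shift.

Section LowerBound.
Context {R : realType} {I : eqType}.
Implicit Types (s : seq I) (c p : I -> R) (t h z : R).
Local Notation mu := (@lebesgue_measure R).

(** Removing the frequencies of [s] one at a time by [exp_sum_sqr_difference]; each
removal shrinks the interval by [h] on both sides and costs a factor [4].  The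
last exponential, that of [o], has constant modulus. *)
Lemma integral_exp_sum_sqr_ge s c p (o : I) (a h : R) : 0 <= a -> 0 <= h ->
  ((2 * a * c o ^+ 2 * \prod_(j <- s) (2 * sin (h * (p o - p j))) ^+ 2)%:E <=
   (4 ^+ size s)%:E *
   \int[mu]_(t in `[(- (a + (size s)%:R * h))%R, (a + (size s)%:R * h)%R])
      (exp_sum_sqr (o :: s) c p t)%:E)%E.
Proof.
move=> a0 h0; elim: s c => [|z s IH] c.
  rewrite big_nil mulr1 expr0 mul1e mul0r addr0.
  under eq_integral => t _.
    rewrite /exp_sum_sqr /cos_sum /sin_sum !big_seq1 !exprMn -mulrDr cos2Dsin2 mulr1.
    over.
  rewrite integral_cst//= lebesgue_measure_itv/= lte_fin.
  case: ifPn => aa.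
    by rewrite -EFinD -EFinM lee_fin opprK [2 * a]mulr_natl mulr2n mulrC.
  rewrite mule0 lee_fin (_ : a = 0) ?mulr0 ?mul0r//.
  by apply/eqP; move: aa; rewrite -leNgt; lra.
have c_f d u : continuous (fun t => exp_sum_sqr d c p (t + u)).
  move=> t; apply: (@continuous_comp R R R (fun t : R => t + u)).
    by apply: continuousD; [exact: cvg_id|exact: cvg_cst].
  exact: continuous_exp_sum_sqr.
have m_f d (A : set R) u : measurable_fun A (fun t => (exp_sum_sqr d c p (t + u))%:E).
  apply/measurable_EFinP; apply: measurable_funTS.
  exact: continuous_measurable_fun.
have m2f d (A : set R) u : measurable_fun A (fun t => (2 * exp_sum_sqr d c p (t + u))%:E).
  apply/measurable_EFinP; apply: measurable_funM => //; apply: measurable_funTS.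
  exact: continuous_measurable_fun.
(* The coefficients after one difference: that of [z] vanishes. *)
pose c' j := 2 * c j * sin (h * (p j - p z)).
rewrite big_cons [leLHS](_ : _ = (2 * a * c' o ^+ 2 *
    \prod_(j <- s) (2 * sin (h * (p o - p j))) ^+ 2)%:E); last first.
  by rewrite /c' -!mulrA; congr EFin; ring.
apply: (le_trans (IH c')).
rewrite [size (z :: s)]/= exprSr EFinM -muleA.
apply: lee_wpmul2l; first by rewrite lee_fin exprn_ge0.
set b := a + (size s)%:R * h.
have b0 : 0 <= b by rewrite addr_ge0 ?mulr_ge0.
have -> : a + (size s).+1%:R * h = b + h by rewrite /b -natr1 mulrDl mul1r addrA.
have e' t : exp_sum_sqr (o :: s) c' p t = exp_sum_sqr [:: o, z & s] c' p t.
  have c'z : c' z = 0 by rewrite /c' subrr mulr0 sin0 mulr0.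
  by rewrite /exp_sum_sqr /cos_sum /sin_sum !big_cons c'z !mul0r !add0r.
apply: (@le_trans _ _ (\int[mu]_(t in `[(- b)%R, b])
   ((2 * exp_sum_sqr [:: o, z & s] c p (t + h))%:E +
    (2 * exp_sum_sqr [:: o, z & s] c p (t - h))%:E)%E)%E).
  apply: ge0_le_integral => //=.
  - by move=> t _; rewrite lee_fin exp_sum_sqr_ge0.
  - apply/measurable_EFinP; apply: measurable_funTS.
    by apply: continuous_measurable_fun; exact: continuous_exp_sum_sqr.
  - by apply: emeasurable_funD; exact: m2f.
  - by move=> t _; rewrite e' -EFinD lee_fin; exact: exp_sum_sqr_difference.
have sq0 t : 0 <= exp_sum_sqr [:: o, z & s] c p t by exact: exp_sum_sqr_ge0.
rewrite ge0_integralD//=; first last.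
- exact: m2f.
- by move=> t _; rewrite lee_fin mulr_ge0.
- exact: m2f.
- by move=> t _; rewrite lee_fin mulr_ge0.
under eq_integral do rewrite EFinM.
rewrite ge0_integralZl_EFin//; last 2 first.
- by move=> t _; rewrite lee_fin.
- exact: m_f.
under [X in (_ + X)%E]eq_integral do rewrite EFinM.
rewrite ge0_integralZl_EFin//; last 2 first.
- by move=> t _; rewrite lee_fin.
- exact: m_f.
have -> : (4%:E = 2%:E + 2%:E :> \bar R)%E by rewrite -EFinD; congr EFin; lra.
rewrite ge0_muleDl ?lee_fin//; apply: leeD; (apply: lee_wpmul2l; first by rewrite lee_fin);
  apply: le_integral_itv_shift => //; try exact: continuous_exp_sum_sqr;
  by rewrite ?normrN ger0_norm.
Qed.

End LowerBound.

(** * Divided differences of exponentials *)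

Section RealAnalysis.
Context {R : realType}.

Lemma le_of_is_derive (f g f' g' : R -> R) (a b : R) : a <= b ->
  (forall u : R, is_derive u 1 f (f' u)) -> (forall u : R, is_derive u 1 g (g' u)) ->
  (forall u, a < u -> u < b -> f' u <= g' u) -> f a <= g a -> f b <= g b.
Proof.
move=> ab df dg fg fga; rewrite -subr_ge0.
have d (u : R) : is_derive u 1 (g - f) (g' u - f' u) by apply: is_deriveB.
suff : (g - f) a <= (g - f) b by move: fga; rewrite !fctE; lra.
apply: (@ger0_derive1_le_cc R (g - f) a b) => //.
- by move=> u; rewrite in_itv/= => /andP[au ub]; rewrite derive1E derive_val subr_ge0 fg.
- apply: continuous_subspaceT => u.
  by apply/differentiable_continuous/derivable1_diffP.
- by rewrite in_itv/= lexx.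
- by rewrite in_itv/= lexx ab.
Qed.

Lemma is_derive_cos_affine (k b u : R) :
  is_derive u 1 (fun t => cos (t * k + b)) (k * cos (u * k + b + pi / 2)).
Proof.
rewrite cosDpihalf.
have d : is_derive u 1 (fun t : R => t * k + b) k.
  rewrite (_ : (fun _ => _) = (k \*: id) + cst b); last first.
    by apply/funext => t; rewrite !fctE mulrC.
  apply: is_derive_eq; by rewrite addr0 /GRing.scale/= mulr1.
apply: (@is_derive_eq _ _ _ (cos \o (fun t : R => t * k + b)) u 1 _ _
   (is_derive1_comp (is_derive_cos _) d)).
by rewrite mulrC.
Qed.

Lemma is_derive_monomial (n : nat) (u : R) :
  is_derive u 1 (fun t => t ^+ n.+1 / n.+1`!%:R) (u ^+ n / n`!%:R).
Proof.
have n1 : n.+1%:R != 0 :> R by rewrite pnatr_eq0.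
have nf : n`!%:R != 0 :> R by rewrite pnatr_eq0 -lt0n fact_gt0.
have dX : is_derive u 1 (fun t : R => t ^+ n.+1) (n.+1%:R * u ^+ n).
  rewrite (_ : (fun _ => _) = id ^+ n.+1); last by apply/funext => t; rewrite exprfctE.
  by apply: is_derive_eq; rewrite /GRing.scale/= mulr1 mulr_natl.
rewrite (_ : (fun _ => _) = (n.+1`!%:R)^-1 \*: (fun t : R => t ^+ n.+1)); last first.
  by apply/funext => t; rewrite /= mulrC.
apply: is_derive_eq.
by rewrite /GRing.scale/= factS natrM; field; rewrite nf ?natr1 ?n1 ?andbT ?(addrC 1) ?natr1.
Qed.

End RealAnalysis.

Section DividedDifferences.
Context {R : realType} {I : eqType}.
Implicit Types (s : seq I) (p phi : I -> R) (a : I).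

Definition node_prod s p a : R := \prod_(i <- s | i != a) (p a - p i).

Definition divided_diff s p phi : R := \sum_(j <- s) phi j / node_prod s p j.

Lemma divided_diff_perm s s' p phi : perm_eq s s' ->
  divided_diff s p phi = divided_diff s' p phi.
Proof.
move=> ss'; rewrite /divided_diff (perm_big _ ss'); apply: eq_bigr => j _.
by rewrite /node_prod (perm_big _ ss').
Qed.

Lemma eq_divided_diff s p phi psi : {in s, phi =1 psi} ->
  divided_diff s p phi = divided_diff s p psi.
Proof.
by move=> e; rewrite /divided_diff !big_seq; apply: eq_bigr => j js; rewrite e.
Qed.

Lemma divided_diff_cons s p phi a : uniq (a :: s) ->
  {in a :: s &, injective p} ->
  divided_diff (a :: s) p (fun j => (p j - p a) * phi j) = divided_diff s p phi.
Proof.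
move=> /=/andP[aNs us] pI.
rewrite /divided_diff big_cons subrr !mul0r add0r !big_seq; apply: eq_bigr => j js.
have aj : a != j by apply: contra aNs => /eqP ->.
rewrite /node_prod big_cons aj invfM mulrACA mulfV ?mul1r// subr_eq0.
apply: contra aj => /eqP e; apply/eqP/esym/pI => //; rewrite inE ?js ?eqxx ?orbT//.
Qed.

(** Newton's recursion
[(p_b - p_a) f[a,b,..] = f[b,..] - f[a,..]], in which [divided_diff_cons] gives
both terms on the right. *)
Lemma divided_diff_cst s p : uniq s -> {in s &, injective p} ->
  divided_diff s p (fun=> 1) = (size s == 1%N)%:R.
Proof.
have [n] := ubnP (size s); elim: n s => // n IH [|a [|b s]].
- by move=> _ _ _; rewrite /divided_diff big_nil.
- by move=> _ _ _; rewrite /divided_diff/node_prod big_seq1 big_mkcond big_seq1 eqxx divr1.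
rewrite ltnS => sn us pI /=.
have := us; rewrite /= inE negb_or => /andP[/andP[ab aNs] /andP[bNs us']].
have pab : p b - p a != 0.
  rewrite subr_eq0; apply: contra ab => /eqP e; apply/eqP/esym/pI => //;
  by rewrite !inE eqxx ?orbT.
have sub c : {subset c :: s <= [:: a, b & s]} -> {in c :: s &, injective p}.
  by move=> cs x y xs ys; apply: pI; exact: cs.
have perm_ba : perm_eq [:: a, b & s] [:: b, a & s].
  by rewrite -[[:: a, b & s]]/([:: a; b] ++ s) -[[:: b, a & s]]/([:: b; a] ++ s)
     perm_cat2r; exact: permEl (perm_catC [:: a] [:: b]).
have e1 : divided_diff [:: a, b & s] p (fun j => (p j - p a) * 1) =
          divided_diff (b :: s) p (fun=> 1) by apply: divided_diff_cons.
have e2 : divided_diff [:: a, b & s] p (fun j => (p j - p b) * 1) =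
          divided_diff (a :: s) p (fun=> 1).
  rewrite (divided_diff_perm _ _ perm_ba) divided_diff_cons//.
    by rewrite -(perm_uniq perm_ba).
  by move=> x y; rewrite -!(perm_mem perm_ba); apply: pI.
apply: (mulfI pab); rewrite mulr0.
transitivity (divided_diff (b :: s) p (fun=> 1) - divided_diff (a :: s) p (fun=> 1)).
  rewrite -e1 -e2 /divided_diff mulr_sumr -sumrB; apply: eq_bigr => j _.
  by rewrite !mulr1 mul1r -mulrBl; congr (_ * _); ring.
rewrite !IH//= ?bNs ?aNs ?us' ?subrr//.
- by apply: sub => x; rewrite !inE => /orP[->|->]; rewrite ?orbT.
- by apply: sub => x; rewrite !inE => /orP[->|->]; rewrite ?orbT.
Qed.

Lemma is_derive_divided_diff s p (phi phi' : R -> I -> R) (u : R) :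
  (forall j, is_derive u 1 (phi^~ j) (phi' u j)) ->
  is_derive u 1 (fun t => divided_diff s p (phi t)) (divided_diff s p (phi' u)).
Proof.
rewrite /divided_diff; move: (node_prod s p) => w dphi.
elim: s => [|j s IH].
  rewrite (_ : (fun _ => _) = cst 0) ?big_nil; first exact: is_derive_cst.
  by apply/funext => t; rewrite big_nil.
rewrite big_cons (_ : (fun _ => _) = ((w j)^-1 \*: (phi^~ j)) \+
    (fun t => \sum_(j <- s) phi t j / w j)); last first.
  by apply/funext => t; rewrite big_cons/= mulrC.
apply: is_deriveD; rewrite mulrC; exact: is_deriveZ.
Qed.

(** After a shift of the phases, differentiating in [t] removes one node, so the bound
follows by integrating the bound for one node less; this is where [1/n!] comes from. *)
Lemma divided_diff_cos_le s p (t b : R) : s != [::] -> uniq s ->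
  {in s &, injective p} -> 0 <= t ->
  divided_diff s p (fun j => cos (t * p j + b)) <=
  t ^+ (size s).-1 / ((size s).-1)`!%:R.
Proof.
elim: s t b => // a [|b s] IH t c _ us pI t0.
  rewrite /divided_diff /node_prod big_seq1 big_mkcond big_seq1 eqxx divr1.
  by rewrite expr0 fact0 divr1 cos_le1.
set s1 := b :: s in IH us pI *.
have us1 : uniq s1 by case/andP: us.
have pI1 : {in s1 &, injective p}.
  by move=> x y xs ys; apply: pI; rewrite inE ?xs ?ys orbT.
(* Subtracting [p a] from the nodes makes the term of [a] independent of [u]. *)
pose A u := divided_diff (a :: s1) p (fun j => cos (u * (p j - p a) + (c + t * p a))).
rewrite (_ : divided_diff _ _ _ = A t); last first.
  by apply: eq_divided_diff => j _; congr cos; ring.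
pose n := size s; rewrite -[(size (a :: s1)).-1]/n.+1.
apply: (@le_of_is_derive R A (fun u => u ^+ n.+1 / n.+1`!%:R)
   (fun u => divided_diff s1 p (fun j => cos (u * p j + (c + (t - u) * p a + pi / 2))))
   (fun u => u ^+ n / n`!%:R) 0 t t0).
- move=> u; rewrite -(divided_diff_cons _ us pI).
  apply: (@is_derive_divided_diff (a :: s1) p
    (fun u j => cos (u * (p j - p a) + (c + t * p a)))
    (fun u j => (p j - p a) * cos (u * p j + (c + (t - u) * p a + pi / 2)))) => j.
  apply: (is_derive_eq (is_derive_cos_affine (p j - p a) (c + t * p a) u)).
  by congr (_ * cos _); ring.
- exact: is_derive_monomial.
- by move=> u u0 _; apply: IH => //; exact: ltW.
- rewrite expr0n mul0r /A.
  rewrite (@eq_divided_diff _ _ _ (fun j => cos (c + t * p a) * 1)); last first.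
    by move=> j _; rewrite mul0r add0r mulr1.
  rewrite /divided_diff; under eq_bigr do rewrite -mulrA.
  by rewrite -mulr_sumr -/(divided_diff _ p (fun=> 1)) divided_diff_cst// mulr0.
Qed.

Lemma divided_diff_cos_norm_le s p (t b : R) : s != [::] -> uniq s ->
  {in s &, injective p} ->
  `|divided_diff s p (fun j => cos (t * p j + b))| <=
  `|t| ^+ (size s).-1 / ((size s).-1)`!%:R.
Proof.
move=> s0 us pI; wlog t0 : t b / 0 <= t => [H|].
  have [|t0] := leP 0 t; first exact: H.
  rewrite (@eq_divided_diff _ _ _ (fun j => cos ((- t) * p j + (- b)))).
    by rewrite -[X in _ <= X ^+ _ / _]normrN; apply: H; rewrite oppr_ge0 ltW.
  by move=> j _; rewrite -cosN; congr cos; ring.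
rewrite (ger0_norm t0) ler_norml divided_diff_cos_le// andbT lerNl.
apply: le_trans (divided_diff_cos_le (b + pi) s0 us pI t0).
rewrite /divided_diff -sumrN; apply: ler_sum => j _.
by rewrite addrA cosDpi mulNr.
Qed.

(** The coefficients are those of the error of Lagrange interpolation at the nodes [s],
which is [\prod_i (p_o - p_i)] times the divided difference at [o :: s]. *)
Lemma exp_sum_sqr_le_prod (s : seq I) p (o : I) :
  uniq (o :: s) -> {in o :: s &, injective p} ->
  exists2 c : I -> R, c o = 1 &
   forall t, exp_sum_sqr (o :: s) c p t <=
   2 * (\prod_(i <- s) (p o - p i) * (`|t| ^+ size s / (size s)`!%:R)) ^+ 2.
Proof.
move=> us pI; set P := \prod_(i <- s) _.
have oNs : o \notin s by case/andP: us.
have P0 : node_prod (o :: s) p o = P.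
  rewrite /node_prod big_cons eqxx/= /P big_seq_cond [RHS]big_seq.
  by apply: eq_bigl => i; apply: andb_idr => si; apply: contra oNs => /eqP <-.
have Pn0 : P != 0.
  rewrite prodf_seq_neq0; apply/allP => i si /=; rewrite subr_eq0.
  apply: contra oNs => /eqP /pI -> //; rewrite ?inE ?eqxx ?si ?orbT//.
exists (fun j => P / node_prod (o :: s) p j); first by rewrite P0 divff.
move=> u.
have b0 := @divided_diff_cos_norm_le (o :: s) p u 0 isT us pI.
have b1 := @divided_diff_cos_norm_le (o :: s) p u (- (pi / 2)) isT us pI.
have e0 : cos_sum (o :: s) (fun j => P / node_prod (o :: s) p j) p u =
    P * divided_diff (o :: s) p (fun j => cos (u * p j + 0)).
  rewrite /cos_sum /divided_diff mulr_sumr; apply: eq_bigr => j _.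
  by rewrite addr0; ring.
have e1 : sin_sum (o :: s) (fun j => P / node_prod (o :: s) p j) p u =
    P * divided_diff (o :: s) p (fun j => cos (u * p j + - (pi / 2))).
  rewrite /sin_sum /divided_diff mulr_sumr; apply: eq_bigr => j _.
  by rewrite cosBpihalf; ring.
set y := `|u| ^+ size s / (size s)`!%:R in b0 b1 *.
have y0 : 0 <= y by rewrite divr_ge0 ?exprn_ge0.
clearbody y.
have sq z : `|z| <= y -> (P * z) ^+ 2 <= (P * y) ^+ 2.
  move=> zy; rewrite !exprMn ler_wpM2l ?sqr_ge0//.
  by rewrite -[z ^+ 2]real_normK ?num_real// lerXn2r ?nnegrE.
by rewrite /exp_sum_sqr e0 e1 mulr_natl mulr2n lerD ?sq.
Qed.

End DividedDifferences.

(** * The convex exponent and its Legendre transform *)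

Section ConvexExponent.
Context {R : realType}.
Variables (S T : R -> R).
Hypothesis S_C2 : C2_on `]0, +oo[ S.
Hypothesis S''_ge0 : forall t : R, 0 < t -> 0 <= S^`(2)%classic t.
Hypothesis S'_cvgy : S^`()%classic t @[t --> +oo] --> +oo.
Hypothesis TS : forall s, T s = S (expR s).
Hypothesis T_cont : continuous T.

Let derivable_S (t : R) : 0 < t -> derivable S t 1.
Proof. by move=> t0; have [|//] := @S_C2 t; rewrite /= in_itv/= t0. Qed.

Let derivable_S' (t : R) : 0 < t -> derivable S^`()%classic t 1.
Proof. by move=> t0; have [|//] := @S_C2 t; rewrite /= in_itv/= t0. Qed.

Lemma within_continuous_derivable (f : R -> R) (a b : R) : 0 < a ->
  (forall t : R, 0 < t -> derivable f t 1) -> {within `[a, b], continuous f}.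
Proof.
move=> a0 df; apply: derivable_within_continuous => t; rewrite in_itv/= => /andP[at_ _].
by apply: df; exact: lt_le_trans at_.
Qed.

Lemma derive1_exponent_le (a b : R) : 0 < a -> a <= b ->
  S^`()%classic a <= S^`()%classic b.
Proof.
move=> a0 ab; apply: (@ger0_derive1_le_cc R S^`()%classic a b) => //.
- move=> t; rewrite in_itv/= => /andP[at_ _]; apply: derivable_S'; exact: lt_trans at_.
- move=> t; rewrite in_itv/= => /andP[at_ _]; apply: S''_ge0; exact: lt_trans at_.
- exact: within_continuous_derivable.
- by rewrite in_itv/= lexx ab.
- by rewrite in_itv/= lexx ab.
Qed.

Lemma exponent_ge_tangent (a t : R) : 0 < a -> 0 < t ->
  S a + S^`()%classic a * (t - a) <= S t.
Proof.
have mvt (u v : R) : 0 < u -> u < v ->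
    exists2 c, c \in `]u, v[ & S v - S u = S^`()%classic c * (v - u).
  move=> u0 uv; apply: MVT => //; last exact: within_continuous_derivable.
  move=> x; rewrite in_itv/= => /andP[ux _].
  have := derivable_S (lt_trans u0 ux) => /derivableP; rewrite derive1E; exact.
move=> a0 t0; have [ta|at_|->] := ltgtP t a; last by rewrite subrr mulr0 addr0.
- have [c /[!in_itv]/= /andP[tc ca] e] := mvt _ _ t0 ta.
  have := derive1_exponent_le (lt_trans t0 tc) (ltW ca) => h.
  have : S^`()%classic c * (a - t) <= S^`()%classic a * (a - t).
    by rewrite ler_wpM2r// subr_ge0 ltW.
  rewrite -e; lra.
- have [c /[!in_itv]/= /andP[ac ct] e] := mvt _ _ a0 at_.
  have := derive1_exponent_le a0 (ltW ac) => h.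
  have : S^`()%classic a * (t - a) <= S^`()%classic c * (t - a).
    by rewrite ler_wpM2r// subr_ge0 ltW.
  rewrite -e; lra.
Qed.

(** The tangent of [S] at a point where [S' >= M]. *)
Lemma exponent_superlinear (M : R) :
  exists c : R, forall t, 0 < t -> M * t - c <= S t.
Proof.
have /cvgryPge/(_ M)[A [_ SA]] := S'_cvgy.
pose a := Num.max 1 (A + 1).
have a0 : 0 < a by rewrite lt_max ltr01.
have Ma : M <= S^`()%classic a by apply: SA; rewrite lt_max; apply/orP; right; lra.
exists (S^`()%classic a * a - S a) => t t0.
apply: le_trans (exponent_ge_tangent a0 t0).
have : M * t <= S^`()%classic a * t by rewrite ler_wpM2r// ltW.
lra.
Qed.

(** As [s --> +oo], [S (expR s)] grows faster than any multiple of [expR s]; as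
[s --> -oo], the term [q s] prevails because [S] is bounded below near [0]. *)
Lemma legendre_attained_of_pos (q : R) : 0 < q -> legendre_attained T q.
Proof.
move=> q0; pose h s := q * s - T s.
suff [s0 hs0] : exists s0, forall s, h s <= h s0.
  have ub : ubound (range h) (h s0) by move=> _ [s _ <-].
  have e : legendre T q = h s0.
    apply/eqP; rewrite eq_le; apply/andP; split.
      by apply: ge_sup => //; exists (h s0), s0.
    by apply: ub_le_sup; [exists (h s0) | exists s0].
  by exists s0; rewrite e.
have [c Sc] := exponent_superlinear (q + 1).
(* Outside [[-B, B]] the function [h] is below [h 0]. *)
pose B := Num.max `|(h 0 - c) / q| `|c - h 0|.
have B0 : 0 <= B by rewrite le_max normr_ge0.
have hc : {within `[- B, B], continuous h}.
  apply: continuous_subspaceT => s; apply: continuousB; last exact: T_cont.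
  by apply: continuousM; [exact: cvg_cst | exact: cvg_id].
have [|s0 s0B hs0] := EVT_max _ hc; first lra.
have h00 : h 0 <= h s0 by apply: hs0; rewrite in_itv/=; apply/andP; split; lra.
exists s0 => s.
have [|sB] := boolP (s \in `[- B, B]); first exact: hs0.
apply: le_trans h00.
have Ss : (q + 1) * expR s - c <= T s by rewrite TS; apply: Sc; exact: expR_gt0.
have es := expR_ge1Dx s; have e0 := expR_gt0 s.
have B1 : - B <= (h 0 - c) / q.
  by rewrite lerNl /B le_max -[`|_ / _|]normrN ler_norm.
have B2 : c - h 0 <= B by rewrite /B le_max ler_norm orbT.
rewrite -[h s]/(q * s - T s); have [sn|sp] := ltP s (- B).
  have : s * q <= h 0 - c by rewrite -ler_pdivlMr//; lra.
  have : 0 <= (q + 1) * expR s by rewrite mulr_ge0 ?expR_ge0//; lra.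
  lra.
have {sB} sB : B < s by rewrite ltNge; apply: contra sB => ?; rewrite in_itv/= sp.
have : (q + 1) * (1 + s) <= (q + 1) * expR s by rewrite ler_wpM2l//; lra.
lra.
Qed.

(** The maximum of [q s - M expR s], attained at [expR s = q / M]. *)
Lemma legendre_le (q M : R) : 0 < q -> 0 < M ->
  forall c, (forall t, 0 < t -> M * t - c <= S t) ->
  legendre T q <= q * ln (q / M) - q + c.
Proof.
move=> q0 M0 c Sc; have [s0 [-> _]] := legendre_attained_of_pos q0.
have := Sc _ (expR_gt0 s0); rewrite -TS.
have qM : 0 < q / M by rewrite divr_gt0.
have := expR_ge1Dx (s0 - ln (q / M)).
rewrite expRB lnK ?posrE// invf_div mulrA ler_pdivlMr// => h.
have : q * (1 + (s0 - ln (q / M))) <= M * expR s0 by rewrite mulrC [M * _]mulrC.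
lra.
Qed.

(** By [legendre_le], [T^*(q) <= q ln (q / M) - q + c] for every [M], whereas the rate
subtracts [q ln K] with [q / K <= 3]; hence a large [M] wins. *)
Lemma EI_rate_superlinear (B : R) : 0 <= B -> exists c : R, forall K, (0 < K)%N ->
  EI_rate T K <= c - B * K%:R.
Proof.
move=> B0; pose M := expR (B + 2); have M0 : 0 < M by exact: expR_gt0.
have [c Sc] := exponent_superlinear M; exists c => K K0.
pose q : R := (2 * K + 1)%:R; pose k : R := K%:R.
have k1 : 1 <= k by rewrite ler1n.
have qE : q = 2 * k + 1 by rewrite /q natrD natrM.
have q0 : 0 < q by lra.
rewrite /EI_rate -/q -/k; have := legendre_le q0 M0 Sc.
have k0 : 0 < k by lra.
have -> : ln (q / M) = ln k + ln (q / k) - (B + 2).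
  rewrite -lnM ?posrE ?divr_gt0// mulrCA mulfV ?gt_eqF// mulr1.
  by rewrite lnM ?posrE ?invr_gt0// lnV ?posrE// expRK.
have : ln (q / k) <= 2.
  have : ln (1 + (q / k - 1)) <= q / k - 1.
    apply: le_ln1Dx; have := divr_gt0 q0 k0; lra.
  rewrite addrC subrK => /le_trans; apply.
  have : q / k <= 3 by rewrite ler_pdivrMr//; lra.
  lra.
move=> l; have : q * ln (q / k) <= q * 2 by rewrite ler_wpM2l// ltW.
have : B * k <= B * q by rewrite ler_wpM2l//; lra.
lra.
Qed.

(** [tau] is the maximizer of [t^q Ghat(t)] for [q = 2K+1], so that [S' tau = q / tau].
With [u = t / tau], the tangent of [S] at [tau] gives a factor [expR (- q (u - 1))],
and [u <= expR (u - 1)] absorbs [u^(2K)] in all but one unit of the exponent. *)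
Lemma moment_integrand_le K : exists2 tau : R, 0 < tau & forall t : R, 0 < t ->
  t ^+ (2 * K) * expR (- S t) <=
  expR (legendre T (2 * K + 1)%:R) / tau * expR (1 - t / tau).
Proof.
set q := (2 * K + 1)%:R; have q0 : 0 < q :> R by rewrite ltr0n addn1.
have [s0 [LE Lub]] := legendre_attained_of_pos q0.
pose tau := expR s0; have tau0 : 0 < tau by exact: expR_gt0.
have S'tau : S^`()%classic tau = q / tau.
  pose h t : R := q * ln t - S t.
  have dh (t : R) : 0 < t -> is_derive t 1 h (q * t^-1 - S^`()%classic t).
    move=> t0; rewrite (_ : h = q \*: @ln R - S)//.
    apply: is_deriveB.
      by apply: is_deriveZ; exact: is_derive1_ln.
    by rewrite derive1E; apply/derivableP/derivable_S.
  have tau_in : tau \in `](tau / 2), (2 * tau)[ by rewrite in_itv/=; apply/andP; split; lra.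
  have : is_derive tau 1 h 0.
    apply: (@derive1_at_max R h (tau / 2) (2 * tau)) => //.
    - lra.
    - move=> t; rewrite in_itv/= => /andP[t0 _].
      have [] := dh t _ => //; lra.
    - move=> t; rewrite in_itv/= => /andP[t0 _].
      have t00 : 0 < t by lra.
      have := Lub (ln t); rewrite LE !TS lnK ?posrE//.
      by rewrite /h /tau expRK.
  case=> _ e; have [_ e'] := dh _ tau0; move: e; rewrite e'; lra.
exists tau => // t t0; pose u := t / tau.
have u0 : 0 < u by rewrite divr_gt0.
have tE : t = tau * u by rewrite /u mulrCA mulfV ?gt_eqF// mulr1.
have St : S tau + q * (u - 1) <= S t.
  have := exponent_ge_tangent tau0 t0; rewrite S'tau.
  suff -> : q / tau * (t - tau) = q * (u - 1) by [].
  by rewrite /u; field; rewrite gt_eqF.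
have Le : expR (legendre T q) / tau = tau ^+ (2 * K) * expR (- S tau).
  rewrite LE TS -/tau expRD expRM_natl -/tau addn1 exprS.
  by field; rewrite gt_eqF.
rewrite Le -/u [X in X ^+ _]tE exprMn -!mulrA ler_wpM2l ?exprn_ge0 ?(ltW tau0)//.
apply: (@le_trans _ _ (expR ((2 * K)%:R * (u - 1)) * expR (- (S tau + q * (u - 1))))).
  apply: ler_pM; rewrite ?exprn_ge0 ?expR_ge0 ?(ltW u0)//; last by rewrite ler_expR lerN2.
  rewrite expRM_natl; apply: lerXn2r; rewrite ?nnegrE ?expR_ge0 ?(ltW u0)//.
  have := expR_ge1Dx (u - 1); lra.
rewrite -!expRD ler_expR /q natrD; lra.
Qed.

End ConvexExponent.

(** * Spectral representation of quadratic forms *)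

Section TrigonometricBounds.
Context {R : realType}.
Implicit Types u : R.

Lemma sin_le u : 0 <= u -> sin u <= u.
Proof.
move=> u0; apply: (@le_of_is_derive R sin id cos (fun=> 1) 0 u u0).
- by move=> v _ _; exact: cos_le1.
- by rewrite sin0.
Qed.

Let sqr_half (v : R) : is_derive v 1 (fun t => t ^+ 2 / 2 : R) v.
Proof. by apply: is_derive_eq (is_derive_monomial 1 v) _; rewrite expr1 divr1. Qed.

Let one_sub_cos (v : R) : is_derive v 1 (fun t => 1 - cos t : R) (sin v).
Proof.
rewrite (_ : (fun _ => _) = cst 1 - cos) //.
by apply: is_derive_eq; rewrite sub0r opprK.
Qed.

Lemma cos_ge_quadratic u : 1 - u ^+ 2 / 2 <= cos u.
Proof.
wlog u0 : u / 0 <= u => [H|].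
  have [/H//|u0] := leP 0 u; rewrite -cosN -sqrrN; apply: H; rewrite oppr_ge0; exact: ltW.
suff : 1 - cos u <= u ^+ 2 / 2 by lra.
apply: (@le_of_is_derive R (fun t => 1 - cos t) (fun t => t ^+ 2 / 2) sin id 0 u u0).
- exact: one_sub_cos.
- exact: sqr_half.
- by move=> v v0 _; apply: sin_le; exact: ltW.
- by rewrite cos0 expr0n mul0r subrr.
Qed.

Lemma sin_ge_half u : 0 <= u <= 1 -> u / 2 <= sin u.
Proof.
move=> /andP[u0 u1].
apply: (@le_of_is_derive R (fun t => t / 2) sin (fun=> 2^-1) cos 0 u u0).
- move=> v; rewrite (_ : (fun _ => _) = 2^-1 \*: (id : R -> R)).
    by apply: is_derive_eq; rewrite /GRing.scale/= mulr1.
  by apply/funext => t; rewrite /= mulrC.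
- move=> v v0 vu; apply: le_trans (cos_ge_quadratic v).
  have : v ^+ 2 <= 1 by rewrite expr_le1// ltW//; lra.
  lra.
- by rewrite sin0 mul0r.
Qed.

Lemma cos_le_quadratic u : `|u| <= 1 -> cos u <= 1 - u ^+ 2 / 4.
Proof.
wlog u0 : u / 0 <= u => [H|].
  have [/H//|u0] := leP 0 u; rewrite -cosN -sqrrN -normrN; apply: H; rewrite oppr_ge0; exact: ltW.
rewrite ger0_norm// => u1.
suff : u ^+ 2 / 2 / 2 <= 1 - cos u by lra.
apply: (@le_of_is_derive R (fun t => t ^+ 2 / 2 / 2) (fun t => 1 - cos t)
  (fun t => t / 2) sin 0 u u0).
- move=> v; rewrite (_ : (fun _ => _) = 2^-1 \*: (fun t : R => t ^+ 2 / 2)).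
    have := sqr_half v => ?.
    by apply: is_derive_eq; rewrite /GRing.scale/= mulrC.
  by apply/funext => t; rewrite /= mulrC.
- exact: one_sub_cos.
- by move=> v v0 vu; apply: sin_ge_half; rewrite !ltW//; lra.
- by rewrite cos0 expr0n !mul0r subrr.
Qed.

End TrigonometricBounds.

Section SpectralForms.
Context {R : realType} {I : eqType}.
Local Notation mu := (@lebesgue_measure R).
Variables (G g : R -> R).
Hypothesis g_ge0 : forall t, 0 <= g t.
Hypothesis g_int : mu.-integrable setT (EFin \o g).
Hypothesis GE : forall x, G x = \int[mu]_t (g t * cos (t * x)).
Implicit Types (s : seq I) (c p : I -> R).

Let g_meas : measurable_fun setT g.
Proof. by apply/measurable_EFinP; exact: measurable_int g_int. Qed.

Lemma integrable_density_mul (h : R -> R) (B : R) : measurable_fun setT h ->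
  (forall t, `|h t| <= B) -> mu.-integrable setT (EFin \o (fun t => g t * h t)).
Proof.
move=> mh hB; apply: (@le_integrable _ _ _ mu _ measurableT _ (fun t => B%:E * (g t)%:E)%E).
- by apply/measurable_EFinP; exact: measurable_funM.
- move=> t _; rewrite /= lee_fin normrM [`|g t|]ger0_norm// [leRHS]ger0_norm.
    by rewrite mulrC ler_wpM2r.
  by rewrite mulr_ge0// (le_trans _ (hB t)).
- exact: integrableZl.
Qed.

Lemma integrable_density_cos x : mu.-integrable setT (EFin \o (fun t => g t * cos (t * x))).
Proof.
apply: (@integrable_density_mul _ 1).
  apply: (measurableT_comp (f := cos)) => //.
    by apply: continuous_measurable_fun; exact: continuous_cos.
  exact: measurable_funM.
by move=> t; exact: cos_max.
Qed.

Lemma exp_sum_sqrE s c p t :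
  exp_sum_sqr s c p t = \sum_(j <- s) \sum_(k <- s) c j * c k * cos (t * (p j - p k)).
Proof.
rewrite /exp_sum_sqr /cos_sum /sin_sum !expr2 !big_distrlr/= -big_split/=.
apply: eq_bigr => j _; rewrite -big_split/=; apply: eq_bigr => k _.
by rewrite mulrBr cosB; ring.
Qed.

Lemma Rintegral_sum (J : Type) (r : seq J) (f : J -> R -> R) :
  (forall j, mu.-integrable setT (EFin \o f j)) ->
  mu.-integrable setT (EFin \o (fun t => \sum_(j <- r) f j t)) /\
  \int[mu]_t (\sum_(j <- r) f j t) = \sum_(j <- r) \int[mu]_t f j t.
Proof.
move=> fi; elim: r => [|j r [IH1 IH2]].
  have -> : (fun t => \sum_(j <- [::]) f j t) = cst 0.
    by apply/funext => t; rewrite big_nil.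
  by rewrite big_nil Rintegral_cst// mul0r; split => //; exact: integrable0.
have E : (fun t => \sum_(i <- j :: r) f i t) = (fun t => f j t + \sum_(i <- r) f i t).
  by apply/funext => t; rewrite big_cons.
split.
  rewrite E; exact: (integrableD measurableT (fi j) IH1).
by rewrite E big_cons -IH2 RintegralD.
Qed.

(** Bochner's identity: the quadratic form of the kernel is an integral of squared
moduli of exponential sums. *)
Lemma spectral_form s c p :
  mu.-integrable setT (EFin \o (fun t => g t * exp_sum_sqr s c p t)) /\
  \int[mu]_t (g t * exp_sum_sqr s c p t) =
  \sum_(j <- s) \sum_(k <- s) c j * c k * G (p j - p k).
Proof.
have E : (fun t => g t * exp_sum_sqr s c p t) = (fun t =>
    \sum_(j <- s) \sum_(k <- s) c j * c k * (g t * cos (t * (p j - p k)))).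
  apply/funext => t; rewrite exp_sum_sqrE mulr_sumr; apply: eq_bigr => j _.
  by rewrite mulr_sumr; apply: eq_bigr => k _; ring.
have i2 j k : mu.-integrable setT
    (EFin \o (fun t => c j * c k * (g t * cos (t * (p j - p k))))).
  exact: (@integrableZl _ _ _ mu _ measurableT (c j * c k) _ (integrable_density_cos (p j - p k))).
have [i1 e1] := Rintegral_sum s (fun j => (Rintegral_sum s (i2 j)).1).
split; rewrite E//= e1; apply: eq_bigr => j _.
rewrite (Rintegral_sum s (i2 j)).2; apply: eq_bigr => k _.
by rewrite RintegralZl// -?GE//; exact: integrable_density_cos.
Qed.

Lemma le_integral_Rintegral (D : set R) (h f : R -> R) : measurable D ->
  mu.-integrable setT (EFin \o f) -> measurable_fun setT h -> (forall t, 0 <= f t) ->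
  (forall t, D t -> 0 <= h t <= f t) ->
  (\int[mu]_(t in D) (h t)%:E <= (\int[mu]_t f t)%:E)%E.
Proof.
move=> mD fi mh f0 hf.
have mf : measurable_fun setT f by apply/measurable_EFinP; exact: measurable_int fi.
rewrite fineK; last exact: integrable_fin_num.
apply: (@le_trans _ _ (\int[mu]_(t in D) (f t)%:E)%E).
  apply: ge0_le_integral => //.
  - by move=> t /hf /andP[]; rewrite lee_fin.
  - by apply/measurable_EFinP; exact: measurable_funTS.
  - by apply/measurable_EFinP; exact: measurable_funTS.
  - by move=> t /hf /andP[]; rewrite lee_fin.
apply: ge0_subset_integral => //=.
  exact/measurable_EFinP.
by move=> t _; rewrite lee_fin.
Qed.

Variable gamma : R.
Hypothesis gamma_ge0 : 0 <= gamma.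
Hypothesis g_ge : forall t, `|t| <= 1 -> gamma <= g t.

(** The density is at least [gamma] on [[-1, 1]], so this is
[integral_exp_sum_sqr_ge] with [2 sin u >= u] for [0 <= u <= 1]. *)
Lemma spectral_form_ge s (o : I) c p :
  (forall j, j \in s -> `|p o - p j| <= 2) ->
  gamma * c o ^+ 2 * \prod_(j <- s) (p o - p j) ^+ 2 / (4 * (size s)%:R) ^+ (2 * size s)
  <= \int[mu]_t (g t * exp_sum_sqr (o :: s) c p t).
Proof.
(* With this step the [n] differences shrink [[-1, 1]] to [[-1/2, 1/2]]; for [n = 0]
   it is [0], which is harmless. *)
move=> p2; set n := size s; pose h : R := (2 * n%:R)^-1.
have h0 : 0 <= h by rewrite invr_ge0 mulr_ge0.
have a0 : 0 <= 2^-1 :> R by lra.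
have := integral_exp_sum_sqr_ge s c p o a0 h0; rewrite -/n.
set J := (\int[mu]_(t in _) _)%E => L.
have nh : 2^-1 + n%:R * h <= 1.
  case: (posnP n) => [->|n0]; first by rewrite mul0r; lra.
  have n0' : n%:R != 0 :> R by rewrite pnatr_eq0 -lt0n.
  have -> : n%:R * h = 2^-1 by rewrite /h; field; rewrite n0'.
  lra.
have J' : (gamma%:E * J <= (\int[mu]_t (g t * exp_sum_sqr (o :: s) c p t))%:E)%E.
  rewrite /J -ge0_integralZl_EFin//; last 2 first.
  - by move=> t _; rewrite lee_fin exp_sum_sqr_ge0.
  - apply/measurable_EFinP; apply: measurable_funTS.
    apply: continuous_measurable_fun; exact: continuous_exp_sum_sqr.
  under eq_integral do rewrite -EFinM.
  apply: le_integral_Rintegral => //.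
  - exact: (spectral_form (o :: s) c p).1.
  - apply: measurable_funM => //.
    by apply: continuous_measurable_fun; exact: continuous_exp_sum_sqr.
  - by move=> t; rewrite mulr_ge0// exp_sum_sqr_ge0.
  - move=> t; rewrite /= in_itv/= => /andP[t1 t2].
    rewrite mulr_ge0 ?exp_sum_sqr_ge0//= ler_wpM2r ?exp_sum_sqr_ge0//.
    by apply: g_ge; rewrite ler_norml; apply/andP; split; lra.
rewrite -lee_fin; apply: le_trans J'.
have L' : ((4 ^+ n)^-1%:E * (c o ^+ 2 * \prod_(j <- s) (2 * sin (h * (p o - p j))) ^+ 2)%:E <= J)%E.
  rewrite lee_pdivrMl ?exprn_gt0//; apply: le_trans L.
  by rewrite mulfV ?mul1r.
apply: le_trans (lee_wpmul2l _ L'); last by rewrite lee_fin.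
set P := \prod_(j <- s) _; set D := (4 * n%:R) ^+ _; set Q := \prod_(j <- s) _.
rewrite -!EFinM lee_fin [leLHS](_ : _ = gamma * (c o ^+ 2 * (P / D))); last by ring.
rewrite [leRHS](_ : _ = gamma * (c o ^+ 2 * (Q / 4 ^+ n))); last by ring.
rewrite ler_wpM2l// ler_wpM2l ?sqr_ge0//.
have [n0|n0] := posnP n.
  have s0 : s = [::] by apply/eqP; rewrite -size_eq0 -/n n0.
  by rewrite /P /Q /D n0 s0 !big_nil.
have n0' : 0 < n%:R :> R by rewrite ltr0n.
have D0 : D = 4 ^+ n * \prod_(j <- s) (4 * n%:R ^+ 2).
  have -> : \prod_(j <- s) (4 * n%:R ^+ 2) = (4 * n%:R ^+ 2) ^+ n :> R.
    by rewrite big_const_seq count_predT iter_mulr_1.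
  by rewrite /D exprM -exprMn; congr (_ ^+ _); ring.
rewrite ler_pdivlMr ?exprn_gt0// mulrC mulrA ler_pdivrMr; last first.
  by rewrite /D exprn_gt0// mulr_gt0.
rewrite D0 mulrCA ler_wpM2l ?exprn_ge0// /P /Q mulrC -big_split/= !big_seq.
apply: ler_prod => j js; rewrite sqr_ge0/=.
have dj := p2 _ js; set d := p o - p j in dj *.
have key : `|d| <= 2 * n%:R * `|2 * sin (h * d)|.
  have hd : h * `|d| / 2 <= sin (h * `|d|).
    apply: sin_ge_half; rewrite mulr_ge0//= /h mulrC ler_pdivrMr ?mulr_gt0// mul1r.
    by apply: le_trans dj _; rewrite ler_peMr// ler1n.
  have -> : `|2 * sin (h * d)| = 2 * sin (h * `|d|).
    have sp : 0 <= sin (h * `|d|) by apply: le_trans hd; rewrite !mulr_ge0.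
    rewrite normrM ger0_norm//; congr (_ * _).
    have [d0|d0] := leP 0 d.
      by rewrite (ger0_norm d0) in sp *; rewrite ger0_norm.
    rewrite -[sin (h * d)]opprK -sinN -mulrN -(ltr0_norm d0) normrN; exact: ger0_norm.
  have e : `|d| = 2 * n%:R * (2 * (h * `|d| / 2)).
    by rewrite /h; field; rewrite gt_eqF.
  by rewrite [leLHS]e ler_wpM2l ?mulr_ge0// ler_wpM2l.
rewrite [leRHS](_ : _ = (2 * n%:R * `|2 * sin (h * d)|) ^+ 2).
  by rewrite -real_normK ?num_real// lerXn2r ?nnegrE// !mulr_ge0.
by rewrite [RHS]exprMn real_normK ?num_real//; ring.
Qed.

End SpectralForms.

(** * Moments of the density and flatness of the kernel at the origin *)

Section Moments.
Context {R : realType}.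
Local Notation mu := (@lebesgue_measure R).

Lemma continuous_two_sided_exp (tau : R) :
  continuous (fun t : R => expR (1 - `|t| / tau) / tau).
Proof.
move=> t; apply: (@continuousM R R (fun t : R => expR (1 - `|t| / tau)) (fun=> tau^-1)); last exact: cvg_cst.
apply: (@continuous_comp R R R (fun t : R => 1 - `|t| / tau) expR); last exact: continuous_expR.
apply: (@continuousB _ R^o); first exact: cvg_cst.
apply: continuousM; last exact: cvg_cst.
exact: norm_continuous.
Qed.

Lemma integral_two_sided_exp_le (tau : R) : 0 < tau ->
  (\int[mu]_t (expR (1 - `|t| / tau) / tau)%:E <= (2 * expR 1)%:E)%E.
Proof.
move=> tau0; rewrite ge0_symfun_integralT; first last.
- by move=> t; rewrite /= normrN.
- exact: continuous_two_sided_exp.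
- by move=> t; rewrite divr_ge0 ?expR_ge0// ltW.
have r0 : 0 < tau^-1 by rewrite invr_gt0.
rewrite EFinM; apply: lee_wpmul2l; first by rewrite lee_fin.
rewrite -set_itvcy.
apply: (@le_trans _ _ (\int[mu]_(t in `[0%R, +oo[) ((expR 1)%:E * (exponential_pdf tau^-1 t)%:E)%E)%E).
  rewrite le_eqVlt; apply/orP; left; apply/eqP; apply: eq_integral => t.
  rewrite inE/= in_itv/= andbT => t0.
  rewrite exponential_pdfE// -EFinM ger0_norm//; congr EFin.
  by rewrite mulrCA -expRD mulrC; congr (_ * expR _); ring.
have mexp : measurable_fun setT (exponential_pdf tau^-1 : R -> R).
  by apply: measurable_exponential_pdf; exact: ltW.
have exp0 t : (0 <= (exponential_pdf tau^-1 t)%:E)%E.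
  by rewrite lee_fin; apply: exponential_pdf_ge0; exact: ltW.
rewrite ge0_integralZl_EFin ?expR_ge0//; last first.
  by apply/measurable_EFinP; exact: measurable_funTS.
rewrite -[leRHS]mule1; apply: lee_wpmul2l; first by rewrite lee_fin expR_ge0.
rewrite -(integral_exponential_pdf r0); apply: ge0_subset_integral => //.
exact/measurable_EFinP.
Qed.

Lemma moment_le (g : R -> R) (n : nat) (tau L : R) : 0 < tau -> 0 <= L ->
  measurable_fun setT g -> (forall t, 0 <= g t) ->
  (forall t, g t * t ^+ n.*2 <= L / tau * expR (1 - `|t| / tau)) ->
  mu.-integrable setT (EFin \o (fun t => g t * t ^+ n.*2)) /\
  \int[mu]_t (g t * t ^+ n.*2) <= 2 * expR 1 * L.
Proof.
move=> tau0 L0 mg g0 gL.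
have f0 t : 0 <= g t * t ^+ n.*2 by rewrite mulr_ge0// -muln2 mulnC exprM exprn_ge0// sqr_ge0.
have mf : measurable_fun setT (fun t => g t * t ^+ n.*2).
  by apply: measurable_funM => //; exact: exprn_measurable.
have m2e : measurable_fun setT (fun t : R => (expR (1 - `|t| / tau) / tau)%:E).
  apply/measurable_EFinP; apply: continuous_measurable_fun.
  exact: continuous_two_sided_exp.
have le : (\int[mu]_t (g t * t ^+ n.*2)%:E <= (2 * expR 1 * L)%:E)%E.
  apply: (@le_trans _ _ (\int[mu]_t (L%:E * (expR (1 - `|t| / tau) / tau)%:E)%E)%E).
    apply: ge0_le_integral => //.
    - by move=> t _; rewrite lee_fin.
    - exact/measurable_EFinP.
    - by apply: measurable_funeM; exact: m2e.
    - by move=> t _; rewrite -EFinM lee_fin (le_trans (gL t))// mulrA mulrAC.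
  rewrite ge0_integralZl_EFin//; last first.
    by move=> t _; rewrite lee_fin divr_ge0 ?expR_ge0// ltW.
  rewrite [2 * _ * _]mulrC EFinM; apply: lee_wpmul2l; [by rewrite lee_fin | exact: integral_two_sided_exp_le].
have fi : mu.-integrable setT (EFin \o (fun t => g t * t ^+ n.*2)).
  apply/integrableP; split; first exact/measurable_EFinP.
  under eq_integral do rewrite /= ger0_norm//.
  exact: le_lt_trans le (ltry _).
split => //; rewrite -lee_fin fineK//; exact: integrable_fin_num.
Qed.

End Moments.

Section KernelEstimates.
Context {R : realType}.
Local Notation mu := (@lebesgue_measure R).
Variables (G g : R -> R).
Hypothesis g_ge0 : forall t, 0 <= g t.
Hypothesis g_int : mu.-integrable setT (EFin \o g).
Hypothesis GE : forall x, G x = \int[mu]_t (g t * cos (t * x)).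

Lemma spectral_form_le (I : eqType) (s : seq I) (o : I) (p : I -> R) :
  uniq (o :: s) -> {in o :: s &, injective p} ->
  mu.-integrable setT (EFin \o (fun t => g t * t ^+ (size s).*2)) ->
  exists2 c : I -> R, c o = 1 &
  \int[mu]_t (g t * exp_sum_sqr (o :: s) c p t) <=
  2 * \prod_(j <- s) (p o - p j) ^+ 2 / (size s)`!%:R ^+ 2 *
  \int[mu]_t (g t * t ^+ (size s).*2).
Proof.
move=> us pI mi; have [c c1 cE] := exp_sum_sqr_le_prod us pI.
exists c => //; set A := 2 * _ / _.
rewrite -RintegralZl//.
apply: le_Rintegral => //.
- exact: (spectral_form g_ge0 g_int GE (o :: s) c p).1.
- exact: (@integrableZl _ _ _ mu _ measurableT A _ mi).
- move=> t _; rewrite mulrCA ler_wpM2l//; apply: le_trans (cE t) _.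
  have tn : (`|t| ^+ size s) ^+ 2 = t ^+ (size s).*2.
    by rewrite exprAC real_normK ?num_real// -exprM mul2n.
  by rewrite /A prodrXl exprMn expr_div_n tn !mulrA [_ * t ^+ _ / _]mulrAC.
Qed.

Lemma kernelN x : G (- x) = G x.
Proof. by rewrite !GE; apply: eq_Rintegral => t _; rewrite mulrN cosN. Qed.

Lemma integrable_drop y : mu.-integrable setT
  (EFin \o (fun t => g t * cos (t * 0) - g t * cos (t * y))).
Proof.
exact: (integrableB measurableT (integrable_density_cos g_ge0 g_int 0)
  (integrable_density_cos g_ge0 g_int y)).
Qed.

Lemma kernel_drop_le y : mu.-integrable setT (EFin \o (fun t => g t * t ^+ 2)) ->
  G 0 - G y <= (\int[mu]_t (g t * t ^+ 2) / 2) * y ^+ 2.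
Proof.
move=> i2; rewrite !GE -RintegralB//; try exact: integrable_density_cos.
rewrite -mulrA mulrC -RintegralZl//.
apply: le_Rintegral => //.
- exact: integrable_drop.
- exact: (@integrableZl _ _ _ mu _ measurableT _ _ i2).
- move=> t _; rewrite mulr0 cos0 mulrCA -mulrBr ler_wpM2l//.
  have := cos_ge_quadratic (t * y); rewrite exprMn; lra.
Qed.

(** Only the frequencies in [[1/2, 1]] are used: there [1 - cos (t y) >= y^2 / 16]. *)
Lemma kernel_drop_ge (gamma y : R) : 0 <= gamma -> `|y| <= 1 ->
  (forall t, `|t| <= 1 -> gamma <= g t) -> gamma / 32 * y ^+ 2 <= G 0 - G y.
Proof.
move=> gam0 y1 gg; rewrite !GE -RintegralB//; try exact: integrable_density_cos.
have mD : measurable (`[2^-1, 1] : set R) by [].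
rewrite -lee_fin.
have f0 t : 0 <= g t * cos (t * 0) - g t * cos (t * y).
  by rewrite mulr0 cos0 -mulrBr mulr_ge0// subr_ge0 cos_le1.
apply: (@le_trans _ _ (\int[mu]_(t in `[(2^-1)%R, 1%R]) (gamma / 16 * y ^+ 2)%:E)%E).
  rewrite integral_cst//= lebesgue_measure_itv/= lte_fin ifT; last lra.
  rewrite -EFinD -EFinM lee_fin; lra.
apply: (@le_integral_Rintegral R _ (fun=> gamma / 16 * y ^+ 2)
  (fun t => g t * cos (t * 0) - g t * cos (t * y))) => //.
- exact: integrable_drop.
- move=> t; rewrite /= in_itv/= => /andP[t1 t2].
  apply/andP; split; first by rewrite mulr_ge0 ?sqr_ge0 ?divr_ge0.
  rewrite mulr0 cos0 -mulrBr [leLHS](_ : _ = gamma * (y ^+ 2 / 16)); last by ring.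
  apply: ler_pM => //.
  + by rewrite divr_ge0 ?sqr_ge0.
  + by apply: gg; rewrite ger0_norm//; lra.
  have ty : `|t * y| <= 1.
    by rewrite normrM mulr_ile1// ger0_norm//; lra.
  have := cos_le_quadratic ty; rewrite exprMn.
  have : (2^-1) ^+ 2 * y ^+ 2 <= t ^+ 2 * y ^+ 2.
    by rewrite ler_wpM2r ?sqr_ge0// lerXn2r ?nnegrE//; lra.
  lra.
Qed.

End KernelEstimates.

(** * Conditional variance *)

Section Kriging.
Context {R : realType}.
Local Notation mu := (@lebesgue_measure R).
Variables (G g : R -> R) (gamma : R).
Hypothesis g_ge0 : forall t, 0 <= g t.
Hypothesis g_int : mu.-integrable setT (EFin \o g).
Hypothesis GE : forall x, G x = \int[mu]_t (g t * cos (t * x)).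
Hypothesis gamma_gt0 : 0 < gamma.
Hypothesis g_ge : forall t, `|t| <= 1 -> gamma <= g t.

Variables (x : nat -> R) (K : nat).
Let A := gram G x K.
Let node (k : 'I_K) : R := x k.+1.
Hypothesis node_inj : injective node.
Hypothesis node_dom : forall k, `|node k| <= 1.

Let quad (v : 'cV[R]_K) : R := (v^T *m A *m v) 0 0.

Let quadE v : quad v =
  \sum_(j <- enum 'I_K) \sum_(k <- enum 'I_K) v j 0 * v k 0 * G (node j - node k).
Proof.
rewrite /quad mxE exchange_big/= big_enum/=; apply: eq_bigr => k _.
rewrite mxE big_enum/= mulr_suml; apply: eq_bigr => j _.
by rewrite !mxE mulrAC mulrC; ring.
Qed.

Let quad_form v : quad v =
  \int[mu]_t (g t * exp_sum_sqr (enum 'I_K) (fun k => v k 0) node t).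
Proof. by rewrite quadE (spectral_form g_ge0 g_int GE _ _ _).2. Qed.

Let quad_ge0 v : 0 <= quad v.
Proof.
by rewrite quad_form; apply: Rintegral_ge0 => t _; rewrite mulr_ge0// exp_sum_sqr_ge0.
Qed.

Let gram_sym : A^T = A.
Proof. by apply/matrixP => j k; rewrite !mxE -(kernelN GE) opprB. Qed.

(** A vector in the kernel of the Gram matrix has zero quadratic form, which
[spectral_form_ge] forbids as soon as one of its coordinates is nonzero. *)
Lemma gram_unit : A \in unitmx.
Proof.
rewrite -row_free_unit; apply: inj_row_free => v vA.
apply/eqP; apply: contraT => v0.
have [j vj] : exists j, v 0 j != 0.
  apply/existsP; apply: contraNT v0; rewrite negb_exists => /forallP v0.
  by apply/eqP/rowP => j; rewrite mxE; apply/eqP; have := v0 j; rewrite negbK.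
have : quad v^T = 0 by rewrite /quad trmxK vA mul0mx mxE.
have pj : perm_eq (enum 'I_K) (j :: rem j (enum 'I_K)).
  by apply: perm_to_rem; rewrite mem_enum.
have uj : uniq (j :: rem j (enum 'I_K)) by rewrite -(perm_uniq pj) enum_uniq.
rewrite quad_form.
rewrite [X in X = 0](_ : _ = \int[mu]_t (g t * exp_sum_sqr (j :: rem j (enum 'I_K))
    (fun k => v^T k 0) node t)); last first.
  apply: eq_Rintegral => t _; congr (_ * _).
  by rewrite /exp_sum_sqr /cos_sum /sin_sum !(perm_big _ pj).
have := @spectral_form_ge R _ G g g_ge0 g_int GE gamma (ltW gamma_gt0) g_ge
  (rem j (enum 'I_K)) j (fun k => v^T k 0) node.
set s := rem _ _ => /(_ _)/[swap] ->.
move=> H; exfalso.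
have : gamma * v^T j 0 ^+ 2 * \prod_(k <- s) (node j - node k) ^+ 2 /
    (4 * (size s)%:R) ^+ (2 * size s) <= 0.
  apply: H => k _; apply: le_trans (ler_normB _ _) _.
  by rewrite (_ : 2 = 1 + 1)//; apply: lerD.
apply/negP; rewrite -ltNge divr_gt0//.
  apply: mulr_gt0; first by apply: mulr_gt0 => //; rewrite mxE exprn_even_gt0.
  rewrite big_seq; apply: prodr_gt0 => k ks.
  rewrite exprn_even_gt0//= subr_eq0; apply/eqP => /node_inj jk.
  by move: ks uj; rewrite -jk /s /= => ->.
have [->|s0] := posnP (size s); first by rewrite expr0.
by rewrite exprn_gt0// mulr_gt0// ltr0n.
Qed.

Section Point.
Variable y : R.
Let b := kernel_vec G x K y.

Let cond_varE : cond_var G x K y = G 0 - (b^T *m invmx A *m b) 0 0.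
Proof. by []. Qed.

Let form (v : 'cV[R]_K) : R := G 0 + 2 * (b^T *m v) 0 0 + quad v.

(** Completing the square. *)
Let form_cond_var v : form v = cond_var G x K y + quad (v + invmx A *m b).
Proof.
rewrite cond_varE /form /quad; set u := invmx A *m b.
have Au : A *m u = b by rewrite /u mulKVmx// gram_unit.
have uA : u^T *m A = b^T by rewrite -[in LHS]gram_sym -trmx_mul Au.
have vu : (v + u)^T = v^T + u^T by apply/matrixP => i j; rewrite !mxE.
have e : (v + u)^T *m A *m (v + u) =
    v^T *m A *m v + b^T *m v + (v^T *m b + b^T *m u).
  by rewrite vu mulmxDl uA mulmxDr !mulmxDl -[v^T *m A *m u]mulmxA Au.
have vb : (v^T *m b) 0 0 = (b^T *m v) 0 0.
  by rewrite -[in LHS](trmxK b) -trmx_mul mxE.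
have -> : b^T *m invmx A *m b = b^T *m u by rewrite mulmxA.
have eD (M N : 'M[R]_1) : (M + N) 0 0 = M 0 0 + N 0 0 by rewrite mxE.
by rewrite e !eD vb; ring.
Qed.

(** The evaluation point is indexed by [None] and the nodes by [Some k]. *)
Let onode (o : option 'I_K) : R := if o is Some k then node k else y.
Let ocoef (v : 'cV[R]_K) (o : option 'I_K) : R := if o is Some k then v k 0 else 1.
Let onodes := [seq Some k | k <- enum 'I_K].

Let formE v : form v =
  \int[mu]_t (g t * exp_sum_sqr (None :: onodes) (ocoef v) onode t).
Proof.
rewrite (spectral_form g_ge0 g_int GE _ _ _).2 big_cons big_cons big_map /=.
rewrite [X in _ + X]big_map.
under [X in _ = _ + X]eq_bigr do rewrite big_cons big_map/=.
rewrite big_split/= -quadE subrr !mulr1 mul1r /form [in LHS]mxE.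
have -> : \sum_(i < K) b^T 0 i * v i 0 = \sum_(j <- enum 'I_K) v j 0 * G (y - node j).
  by rewrite big_enum; apply: eq_bigr => j _; rewrite !mxE mulrC.
rewrite addrA; congr (_ + _); rewrite -addrA; congr (_ + _).
rewrite mulr_natl mulr2n; congr (_ + _); apply: eq_bigr => j _.
  by rewrite mul1r.
by rewrite mulr1 -(kernelN GE) opprB.
Qed.

Lemma cond_var_ge0 : 0 <= cond_var G x K y.
Proof.
have -> : cond_var G x K y = form (- (invmx A *m b)).
  by rewrite form_cond_var addNr /quad mulmx0 mxE addr0.
by rewrite formE; apply: Rintegral_ge0 => t _; rewrite mulr_ge0// exp_sum_sqr_ge0.
Qed.

Lemma cond_var_ge : `|y| <= 1 ->
  gamma * \prod_(k < K) (y - x k.+1) ^+ 2 / (4 * K%:R) ^+ (2 * K) <= cond_var G x K y.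
Proof.
move=> y_dom; have -> : cond_var G x K y = form (- (invmx A *m b)).
  by rewrite form_cond_var addNr /quad mulmx0 mxE addr0.
rewrite formE.
have := @spectral_form_ge R _ G g g_ge0 g_int GE gamma (ltW gamma_gt0) g_ge
  onodes None (ocoef (- (invmx A *m b))) onode.
rewrite size_map size_enum_ord expr1n mulr1 big_map big_enum/=; apply => j _.
apply: le_trans (ler_normB _ _) _; rewrite (_ : 2 = 1 + 1)//; apply: lerD => //.
by case: j => /=.
Qed.

(** At a node the conditional variance and the product both vanish; elsewhere the
points are distinct and the variance is at most the form at the Lagrange weights. *)
Lemma cond_var_le : mu.-integrable setT (EFin \o (fun t => g t * t ^+ K.*2)) ->
  cond_var G x K y <=
  2 * \prod_(k < K) (y - x k.+1) ^+ 2 / K`!%:R ^+ 2 * \int[mu]_t (g t * t ^+ K.*2).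
Proof.
move=> mi; have [[k /eqP yk]|yN] := pselect (exists k, node k == y).
  have bk : b = col k A.
    by apply/colP => j; rewrite !mxE -yk -(kernelN GE) opprB.
  have -> : cond_var G x K y = 0.
    rewrite cond_varE {2}bk -mulmxA colE mulKmx ?gram_unit// -colE !mxE -yk.
    by rewrite !subrr.
  rewrite (bigD1 k)//= -yk /node subrr expr0n/=.
  by rewrite !mul0r mulr0 !mul0r.
have us : uniq (None :: onodes).
  rewrite /= map_inj_uniq ?enum_uniq ?andbT; last by move=> ? ? [].
  by apply/mapP => -[].
have oI : injective onode.
  move=> [k|] [l|] //=; first by move/node_inj ->.
    by move=> e; exfalso; apply: yN; exists k; apply/eqP.
  by move=> e; exfalso; apply: yN; exists l; apply/eqP.
have := @spectral_form_le R G g g_ge0 g_int GE _ onodes None onode us (in2W oI).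
rewrite size_map size_enum_ord => /(_ mi)[c c0]; rewrite big_map big_enum/=.
apply: le_trans.
have -> : exp_sum_sqr (None :: onodes) c onode =
    exp_sum_sqr (None :: onodes) (ocoef (\col_k c (Some k))) onode.
  apply/funext => t; rewrite /exp_sum_sqr /cos_sum /sin_sum !big_cons !big_map c0/=.
  by congr ((_ + _) ^+ 2 + (_ + _) ^+ 2); apply: eq_bigr => j _; rewrite mxE.
by rewrite -formE form_cond_var lerDl.
Qed.

End Point.

End Kriging.

(** * Improvement of a Gaussian variable *)

Section GaussianImprovement.
Context {R : realType}.
Local Notation mu := (@lebesgue_measure R).
Implicit Types m s v d : R.

(** The normal density is a Radon-Nikodym derivative of the normal law, and such a
derivative is unique almost everywhere. *)
Lemma ge0_integral_normal_prob m s (h : measurableTypeR R -> \bar R) :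
  measurable_fun setT h -> (forall z, 0 <= h z)%E ->
  (\int[normal_prob m s]_z h z = \int[mu]_z (h z * (normal_pdf m s z)%:E))%E.
Proof.
move=> mh h0.
have dom : normal_prob m s `<< mu by exact: normal_prob_dominates.
rewrite -(Radon_Nikodym_SigmaFinite.change_of_variables dom)//.
have mpdf : measurable_fun setT (fun z : measurableTypeR R => (normal_pdf m s z)%:E).
  by apply/measurable_EFinP; exact: measurable_normal_pdf.
have fi := Radon_Nikodym_SigmaFinite.f_integrable dom.
have mf := measurable_int _ fi.
apply: ge0_ae_eq_integral => //.
- exact: emeasurable_funM.
- exact: emeasurable_funM.
- by move=> z _; rewrite mule_ge0// Radon_Nikodym_SigmaFinite.f_ge0.
- by move=> z _; rewrite mule_ge0// lee_fin normal_pdf_ge0.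
- apply: ae_eqe_mul2l; apply: integral_ae_eq => //.
  by move=> E _ mE; rewrite -Radon_Nikodym_SigmaFinite.f_integral.
Qed.

Let improvement (b z : R) : R := b - Num.min b z.

Let improvement_ge0 b z : 0 <= improvement b z.
Proof. by rewrite /improvement subr_ge0 ge_min lexx. Qed.

Let measurable_improvement b : measurable_fun setT (improvement b).
Proof.
apply: measurable_funB => //; exact: measurable_minr.
Qed.

Let normal_pdf_val m s z : s != 0 ->
  normal_pdf m s z = normal_peak s * expR (- (z - m) ^+ 2 / (2 * s ^+ 2)).
Proof. move=> s0; rewrite /normal_pdf (negbTE s0) /normal_fun. by rewrite mulr_natl. Qed.

Let normal_peak_double s : 0 < s -> normal_peak (2 * s) = normal_peak s / 2.
Proof.
move=> s0; rewrite /normal_peak exprMn -invfM; congr (_^-1).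
rewrite -!mulrnAr -mulrA sqrtrM ?sqr_ge0// sqrtr_sqr ger0_norm// mulrC.
by rewrite mulrnAr.
Qed.

(** Doubling the standard deviation leaves three quarters of the Gaussian exponent to
spend.  In units of [s] the exponent is [(u + w)^2 / 2] with [u, w >= 0], so that
the spare part dominates both [w^2 / 4], the claimed gain, and the factor [u],
the amount of the improvement. *)
Lemma improvement_pdf_le m s d z : 0 < s -> 0 <= d ->
  improvement (m - d) z * normal_pdf m s z <=
  2 * s * expR (- d ^+ 2 / (4 * s ^+ 2)) * normal_pdf m (2 * s) z.
Proof.
move=> s0 d0; have sn : s != 0 by rewrite gt_eqF.
rewrite !normal_pdf_val ?mulf_neq0 ?pnatr_eq0// normal_peak_double//.
have pk : 0 < normal_peak s by exact: normal_peak_gt0.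
set E1 := expR _; set E2 := expR _; set E3 := expR _.
rewrite [leLHS]mulrCA [leRHS](_ : _ = normal_peak s * (s * (E2 * E3))); last by field.
rewrite ler_pM2l// /improvement.
have [bz|zb] := leP (m - d) z; first by rewrite subrr mul0r !mulr_ge0 ?expR_ge0// ltW.
pose u := (m - d - z) / s.
have uE : m - d - z = s * u by rewrite /u mulrCA mulfV// mulr1.
rewrite uE -mulrA ler_pM2l// /E1 /E2 /E3 -expRD.
have u0 : 0 <= u by rewrite divr_ge0 ?subr_ge0 ?(ltW zb) ?(ltW s0).
have : u <= expR (u ^+ 2 * (3 / 8)).
  apply: le_trans (expR_ge1Dx _); have := sqr_ge0 (u - 1); rewrite sqrrB; nra.
move=> /(ler_pM u0 (expR_ge0 _) )/(_ (lexx (expR (- (z - m) ^+ 2 / (2 * s ^+ 2))))).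
move=> /le_trans; apply; rewrite -expRD ler_expR.
have -> : z - m = - (s * u + d) by rewrite -uE; ring.
pose w := d / s; have wE : d = s * w by rewrite /w mulrCA mulfV// mulr1.
have w0 : 0 <= w by rewrite divr_ge0// ltW.
rewrite wE.
have -> : - (- (s * u + s * w)) ^+ 2 / (2 * s ^+ 2) = - (u + w) ^+ 2 / 2 by field.
have -> : - (s * w) ^+ 2 / (4 * s ^+ 2) = - w ^+ 2 / 4 by field.
have -> : - (- (s * u + s * w)) ^+ 2 / (2 * (2 * s) ^+ 2) = - (u + w) ^+ 2 / 8 by field.
nra.
Qed.

Lemma integral_improvement_le m s d : 0 < s -> 0 <= d ->
  (\int[normal_prob m s]_z (improvement (m - d) z)%:E <=
   (2 * s * expR (- d ^+ 2 / (4 * s ^+ 2)))%:E)%E.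
Proof.
move=> s0 d0; set C := 2 * s * _.
have C0 : 0 <= C by rewrite !mulr_ge0 ?expR_ge0// ltW.
rewrite ge0_integral_normal_prob//; last 2 first.
- by apply/measurable_EFinP; exact: measurable_improvement.
- by move=> z; rewrite lee_fin.
apply: (@le_trans _ _ (\int[mu]_z (C%:E * (normal_pdf m (2 * s) z)%:E)%E)%E).
  apply: ge0_le_integral => //.
  - by move=> z _; rewrite -EFinM lee_fin mulr_ge0// normal_pdf_ge0.
  - apply/measurable_EFinP/measurable_funM; last exact: measurable_normal_pdf.
    exact: measurable_improvement.
  - apply: measurable_funeM; apply/measurable_EFinP; exact: measurable_normal_pdf.
  - by move=> z _; rewrite -!EFinM lee_fin; exact: improvement_pdf_le.
rewrite ge0_integralZl_EFin//; first by rewrite integral_normal_pdf mule1.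
- by move=> z _; rewrite lee_fin normal_pdf_ge0.
- by apply/measurable_EFinP; exact: measurable_normal_pdf.
Qed.

Definition small_gap_const : R := expR (- (9 / 2)) / Num.sqrt (pi *+ 2).

Lemma small_gap_const_gt0 : 0 < small_gap_const.
Proof. by rewrite divr_gt0 ?expR_gt0// sqrtr_gt0 mulrn_wgt0// pi_gt0. Qed.

(** The event that the Gaussian lies between [3 s] and [2 s] below its mean
already contributes this much. *)
Lemma integral_improvement_ge m s d : 0 < s -> 0 <= d -> d <= s ->
  ((small_gap_const * s)%:E <= \int[normal_prob m s]_z (improvement (m - d) z)%:E)%E.
Proof.
move=> s0 d0 ds; have sn : s != 0 by rewrite gt_eqF.
rewrite ge0_integral_normal_prob//; last 2 first.
- by apply/measurable_EFinP; exact: measurable_improvement.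
- by move=> z; rewrite lee_fin.
set C := s * (normal_peak s * expR (- (9 / 2))).
apply: (@le_trans _ _ (\int[mu]_(z in `[(m - 3 * s)%R, (m - 2 * s)%R]) C%:E)%E).
  rewrite integral_cst//= lebesgue_measure_itv/= lte_fin ifT; last lra.
  rewrite -EFinD -EFinM lee_fin /C /small_gap_const.
  have -> : normal_peak s = (s * Num.sqrt (pi *+ 2))^-1.
    by rewrite /normal_peak -mulrnAr sqrtrM ?sqr_ge0// sqrtr_sqr ger0_norm// ltW.
  have q0 : Num.sqrt (pi *+ 2) != 0 :> R.
    by rewrite gt_eqF// sqrtr_gt0 mulrn_wgt0// pi_gt0.
  rewrite le_eqVlt; apply/orP; left; apply/eqP; field; by rewrite sn q0.
apply: (@le_trans _ _ (\int[mu]_(z in `[(m - 3 * s)%R, (m - 2 * s)%R])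
   ((improvement (m - d) z)%:E * (normal_pdf m s z)%:E)%E)%E).
  apply: ge0_le_integral => //.
  - by move=> z _; rewrite lee_fin !mulr_ge0 ?expR_ge0 ?normal_peak_ge0// ltW.
  - apply/measurable_EFinP/measurable_funTS/measurable_funM; last exact: measurable_normal_pdf.
    exact: measurable_improvement.
  - move=> z; rewrite /= in_itv/= => /andP[z1 z2]; rewrite -EFinM lee_fin.
    rewrite normal_pdf_val// /C; apply: ler_pM; rewrite ?mulr_ge0 ?expR_ge0 ?normal_peak_ge0 ?(ltW s0)//.
      rewrite /improvement; have [|] := leP (m - d) z; lra.
    rewrite ler_wpM2l ?normal_peak_ge0// ler_expR mulNr lerN2.
    rewrite ler_pdivrMr; last by rewrite mulr_gt0// exprn_gt0.
    nra.
apply: ge0_subset_integral => //=.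
- apply/measurable_EFinP/measurable_funM; last exact: measurable_normal_pdf.
  exact: measurable_improvement.
- by move=> z _; rewrite -EFinM lee_fin mulr_ge0// normal_pdf_ge0.
Qed.

Lemma gauss_improvement_le m v d : 0 <= v -> 0 <= d ->
  \int[gauss_law m v]_z (m - d - Num.min (m - d) z) <=
  2 * Num.sqrt v * expR (- d ^+ 2 / (4 * v)).
Proof.
move=> v0 d0; rewrite /gauss_law; case: eqVneq => [->|vn].
  rewrite sqrtr0 mulr0 mul0r /Rintegral integral_dirac//; last first.
    by apply/measurable_EFinP; exact: measurable_improvement.
  by rewrite diracT mul1e/= (min_idPl _) ?subrr//; lra.
have vp : 0 < v by rewrite lt_neqAle eq_sym vn.
have s0 : 0 < Num.sqrt v by rewrite sqrtr_gt0.
have := integral_improvement_le m s0 d0; rewrite sqr_sqrtr//.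
rewrite /Rintegral; set J := integral _ _ _ => JC.
rewrite -lee_fin fineK// ge0_fin_numE; first exact: le_lt_trans JC (ltry _).
by apply: integral_ge0 => z _; rewrite lee_fin; exact: improvement_ge0.
Qed.

Lemma gauss_improvement_ge m v d : 0 <= d -> 0 < v -> d <= Num.sqrt v ->
  small_gap_const * Num.sqrt v <= \int[gauss_law m v]_z (m - d - Num.min (m - d) z).
Proof.
move=> d0 vp ds; rewrite /gauss_law gt_eqF//.
have s0 : 0 < Num.sqrt v by rewrite sqrtr_gt0.
have := integral_improvement_le m s0 d0; have := integral_improvement_ge m s0 d0 ds.
rewrite /Rintegral; set J := integral _ _ _ => CJ JC.
rewrite -lee_fin fineK// ge0_fin_numE; first exact: le_lt_trans JC (ltry _).
by apply: integral_ge0 => z _; rewrite lee_fin; exact: improvement_ge0.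
Qed.

End GaussianImprovement.

(** * Dynamics of the maximizers *)

(** The trajectory enters only through its maximality, and the Gaussian model only
through two-sided bounds for the standard deviation [Num.sqrt (V K y)], the drop
[d y] and the improvement [I K y]. *)
Section Dynamics.
Context {R : realType}.
Variables (V I : nat -> R -> R) (d : R -> R) (x : nat -> R).
Variables (gamma cd Cd c1 amax : R) (alpha : nat -> R).
Hypothesis gamma01 : 0 < gamma <= 1.
Hypothesis cd_gt0 : 0 < cd.
Hypothesis Cd_ge0 : 0 <= Cd.
Hypothesis c1_gt0 : 0 < c1.
Hypothesis alpha_ge0 : forall K, 0 <= alpha K.
Hypothesis alpha_le : forall K, (0 < K)%N -> alpha K <= amax.
Hypothesis x1 : x 1%N = 0.
Hypothesis x_dom : forall k, `|x k.+1| <= 1.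

Definition node_dist (K : nat) (y : R) : R := \prod_(k < K) `|y - x k.+1|.
Definition nodes_distinct (K : nat) : Prop := injective (fun k : 'I_K => x k.+1).
Definition std_floor (K : nat) : R := Num.sqrt gamma / (4 * K%:R) ^+ K.

Hypothesis V_ge : forall K y, (0 < K)%N -> nodes_distinct K -> `|y| <= 1 ->
  std_floor K * node_dist K y <= Num.sqrt (V K y).
Hypothesis V_le : forall K y, (0 < K)%N -> nodes_distinct K -> `|y| <= 1 ->
  Num.sqrt (V K y) <= alpha K * node_dist K y.
Hypothesis d_ge : forall y : R, `|y| <= 1 -> cd * y ^+ 2 <= d y.
Hypothesis d_le : forall y : R, `|y| <= 1 -> d y <= Cd * y ^+ 2.
Hypothesis I_ge : forall K y, (0 < K)%N -> nodes_distinct K -> `|y| <= 1 ->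
  0 < Num.sqrt (V K y) -> d y <= Num.sqrt (V K y) -> c1 * Num.sqrt (V K y) <= I K y.
Hypothesis I_le : forall K y, (0 < K)%N -> nodes_distinct K -> `|y| <= 1 ->
  I K y <= 2 * Num.sqrt (V K y) * expR (- d y ^+ 2 / (4 * Num.sqrt (V K y) ^+ 2)).
Hypothesis I_max : forall K y, (0 < K)%N -> `|y| <= 1 -> I K y <= I K (x K.+1).

Let r (n : nat) : R := \prod_(k < n) `|x k.+2|.

Let node_distS n y : node_dist n.+1 y = `|y| * \prod_(k < n) `|y - x k.+2|.
Proof. by rewrite /node_dist big_ord_recl/= x1 subr0. Qed.

Let rS n : r n.+1 = r n * `|x n.+2|. Proof. by rewrite /r big_ord_recr. Qed.

Let r_ge0 n : 0 <= r n. Proof. exact: prodr_ge0. Qed.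

Let r_le1 n : r n <= 1.
Proof. by apply: prodr_ile1 => k _; rewrite normr_ge0 x_dom. Qed.

Let r_le n (k : 'I_n) : r n <= `|x k.+2|.
Proof.
rewrite /r (bigD1 k)//= ler_piMr//.
by apply: prodr_ile1 => j _; rewrite normr_ge0 x_dom.
Qed.

Let node_dist_ge n y : (forall k : 'I_n, `|y| <= `|x k.+2| / 2) ->
  `|y| * (r n / 2 ^+ n) <= node_dist n.+1 y.
Proof.
move=> yx; rewrite node_distS ler_wpM2l//.
have -> : 2 ^+ n = \prod_(k < n) 2 :> R by rewrite prodr_const card_ord.
rewrite -prodf_div; apply: ler_prod => k _; rewrite divr_ge0//=.
have := lerB_dist (x k.+2) y; rewrite distrC => /(le_trans _); apply.
have := yx k; lra.
Qed.

Let node_dist_le n y : `|y| <= 1 -> node_dist n.+1 y <= `|y| * 2 ^+ n.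
Proof.
move=> y1; rewrite node_distS ler_wpM2l//.
have -> : 2 ^+ n = \prod_(k < n) 2 :> R by rewrite prodr_const card_ord.
apply: ler_prod => k _; rewrite normr_ge0/=.
by have := ler_normB y (x k.+2); have := x_dom k.+1; lra.
Qed.

Let node_dist_le_far n y : (forall k : 'I_n, `|y| <= `|x k.+2|) ->
  node_dist n.+1 y <= `|y| * (2 ^+ n * r n).
Proof.
move=> yx; rewrite node_distS ler_wpM2l//.
have -> : 2 ^+ n = \prod_(k < n) 2 :> R by rewrite prodr_const card_ord.
rewrite -big_split/=; apply: ler_prod => k _; rewrite normr_ge0/=.
by have := ler_normB y (x k.+2); have := yx k; lra.
Qed.

Let std_floor_gt0 n : 0 < std_floor n.+1.
Proof.
case/andP: gamma01 => g0 _.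
by rewrite divr_gt0 ?sqrtr_gt0// exprn_gt0// mulr_gt0// ltr0n.
Qed.

Let std_floor_le1 n : std_floor n.+1 <= 1.
Proof.
case/andP: gamma01 => g0 g1.
rewrite /std_floor ler_pdivrMr ?mul1r; last by rewrite exprn_gt0// mulr_gt0// ltr0n.
apply: (@le_trans _ _ 1); first by rewrite -[leRHS]sqrtr1 ler_wsqrtr.
apply: exprn_ege1; have : 1 <= n.+1%:R :> R by rewrite ler1n.
lra.
Qed.

Let Cd1_gt0 : 0 < Cd + 1. Proof. exact: ltr_wpDl. Qed.

Let amax_ge0 : 0 <= amax. Proof. exact: le_trans (alpha_ge0 1%N) (alpha_le _). Qed.

Let amax1_gt0 : 0 < amax + 1. Proof. exact: ltr_wpDl. Qed.

(** The test point: small enough that [d <= Cd eta^2] is below the lower bound of the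
standard deviation at [eta], and closer to [0] than half of every other node. *)
Let eta n : R := r n / 2 ^+ n.+1 * std_floor n.+1 / (Cd + 1).

Let r_gt0 n : nodes_distinct n.+1 -> 0 < r n.
Proof.
move=> dn; apply: prodr_gt0 => k _; rewrite normr_gt0; apply/eqP => xk.
have := dn ord0 (lift ord0 k); rewrite x1 lift0 xk => /(_ erefl) /(congr1 val).
by rewrite /= /bump.
Qed.

Let improvement_ge n : nodes_distinct n.+1 ->
  c1 * eta n ^+ 2 <= I n.+1 (x n.+2).
Proof.
move=> dn; have rp := r_gt0 dn; have bp := std_floor_gt0 n; have b1 := std_floor_le1 n.
have p2 : 0 < 2 ^+ n :> R by exact: exprn_gt0.
have C1 := Cd1_gt0.
have etaE : eta n = r n / 2 ^+ n * (std_floor n.+1 / (2 * (Cd + 1))).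
  by rewrite /eta exprS; field; rewrite !gt_eqF.
have ep : 0 < eta n by rewrite etaE; apply: mulr_gt0; apply: divr_gt0 => //; exact: mulr_gt0.
have e_le : eta n <= r n / 2.
  have : 1 <= 2 ^+ n :> R by rewrite exprn_ege1//; lra.
  move=> h; rewrite etaE; apply: ler_pM.
  - by apply: divr_ge0; exact: ltW.
  - by apply: divr_ge0; [exact: ltW | apply: mulr_ge0 => //; exact: ltW].
  - by rewrite ler_pdivrMr// ler_peMr.
  - rewrite ler_pdivrMr ?mulr_gt0// mulrA mulVf// mul1r.
    by apply: le_trans b1 _; rewrite lerDr.
have e1 : `|eta n| <= 1 by rewrite gtr0_norm//; have := r_le1 n; lra.
have W : `|eta n| * (r n / 2 ^+ n) <= node_dist n.+1 (eta n).
  by apply: node_dist_ge => k; rewrite gtr0_norm//; have := r_le k; lra.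
have Ve : (Cd + 1) * eta n ^+ 2 <= Num.sqrt (V n.+1 (eta n)).
  apply: le_trans (V_ge (ltn0Sn n) dn e1).
  apply: (@le_trans _ _ (std_floor n.+1 * (`|eta n| * (r n / 2 ^+ n)))); last by rewrite ler_pM2l.
  rewrite gtr0_norm// [leRHS](_ : _ = eta n * (std_floor n.+1 * (r n / 2 ^+ n))); last by ring.
  rewrite expr2 mulrA [(Cd + 1) * _]mulrC -mulrA ler_wpM2l ?(ltW ep)//.
  have -> : (Cd + 1) * eta n = 2^-1 * (std_floor n.+1 * (r n / 2 ^+ n)).
    by rewrite etaE; field; rewrite !gt_eqF.
  rewrite ler_piMl//; last lra.
  by rewrite mulr_ge0 ?(ltW bp)// divr_ge0 ?ltW.
have sp : 0 < Num.sqrt (V n.+1 (eta n)).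
  by apply: lt_le_trans Ve; rewrite mulr_gt0// exprn_gt0.
apply: le_trans (I_max (ltn0Sn n) e1); apply: le_trans (I_ge _ _ _ _ _) => //.
- by rewrite ler_pM2l//; apply: le_trans Ve; rewrite ler_peMl ?sqr_ge0 ?lerDr.
- apply: le_trans (d_le e1) _; apply: le_trans Ve.
  by rewrite ler_wpM2r ?sqr_ge0//; lra.
Qed.

Let improvement_gt0 n : nodes_distinct n.+1 -> 0 < I n.+1 (x n.+2).
Proof.
move=> dn; apply: lt_le_trans (improvement_ge dn).
rewrite mulr_gt0// exprn_gt0// /eta.
apply: divr_gt0; last exact: Cd1_gt0.
by apply: mulr_gt0 => //; apply: divr_gt0; [exact: r_gt0 | exact: exprn_gt0].
Qed.

Let improvement_le n : nodes_distinct n.+1 ->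
  I n.+1 (x n.+2) <= 2 * (alpha n.+1 * node_dist n.+1 (x n.+2)).
Proof.
move=> dn; apply: le_trans (I_le (ltn0Sn n) dn (x_dom _)) _.
apply: le_trans (_ : 2 * Num.sqrt (V n.+1 (x n.+2)) <= _); last first.
  by rewrite ler_wpM2l// V_le.
rewrite ler_piMr ?mulr_ge0 ?sqrtr_ge0// -[leRHS]expR0 ler_expR mulNr oppr_le0.
by rewrite divr_ge0 ?sqr_ge0// mulr_ge0 ?sqr_ge0.
Qed.

(** The maximal improvement is positive, whereas the improvement at a node is zero. *)
Lemma trajectory_distinct n : nodes_distinct n.+1.
Proof.
elim: n => [j k _|n IH]; first by rewrite !ord1.
have : 0 < node_dist n.+1 (x n.+2).
  rewrite lt_neqAle prodr_ge0// andbT eq_sym; apply/eqP => W0.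
  by have := lt_le_trans (improvement_gt0 IH) (improvement_le IH); rewrite W0 !mulr0 ltxx.
move=> /gt_eqF/negbT/prodf_neq0 W.
have new (k : 'I_n.+1) : x n.+2 <> x k.+1.
  by move=> e; have := W k isT; rewrite e subrr normr0 eqxx.
move=> j k; have [jn|jn] := ltnP j n.+1; have [kn|kn] := ltnP k n.+1.
- move=> e; have := IH (Ordinal jn) (Ordinal kn) e => /(congr1 val)/= jk.
  exact: val_inj.
- have -> : x k.+1 = x n.+2 by congr (x _.+1); apply/eqP; rewrite eqn_leq kn -ltnS ltn_ord.
  by move=> e; have := new (Ordinal jn); rewrite e.
- have -> : x j.+1 = x n.+2 by congr (x _.+1); apply/eqP; rewrite eqn_leq jn -ltnS ltn_ord.
  by move=> e; have := new (Ordinal kn); rewrite e.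
- move=> _; apply: val_inj; apply/eqP; rewrite eqn_leq.
  by rewrite (leq_trans _ kn) ?(leq_trans _ jn)// -ltnS ltn_ord.
Qed.

Let c2 : R := c1 / (2 * (amax + 1) * (Cd + 1) ^+ 2).

Let c2_gt0 : 0 < c2.
Proof.
by apply: divr_gt0 => //; apply: mulr_gt0; [exact: mulr_gt0 | exact: exprn_gt0].
Qed.

(** Both bounds on the trajectory compare the improvement with
[2 (amax + 1) 2^K], whence this normalization. *)
Let improvement_lower n : r n ^+ 2 * (c2 * std_floor n.+1 ^+ 2 / 8 ^+ n.+1) <=
  I n.+1 (x n.+2) / (2 * (amax + 1) * 2 ^+ n.+1).
Proof.
have a1 : amax + 1 != 0 by rewrite gt_eqF.
have C1 : Cd + 1 != 0 by rewrite gt_eqF.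
apply: le_trans (_ : c1 * eta n ^+ 2 / (2 * (amax + 1) * 2 ^+ n.+1) <= _); last first.
  rewrite ler_wpM2r ?invr_ge0//.
    by apply: mulr_ge0; [apply: mulr_ge0 => //; exact: ltW | exact: exprn_ge0].
  exact: improvement_ge (@trajectory_distinct n).
rewrite le_eqVlt; apply/orP; left; apply/eqP; rewrite /c2 /eta.
have -> : 8 ^+ n.+1 = 2 ^+ n.+1 * 2 ^+ n.+1 * 2 ^+ n.+1 :> R.
  by rewrite -!exprMn; congr (_ ^+ _); ring.
have : 2 ^+ n.+1 != 0 :> R by rewrite expf_neq0.
move: (2 ^+ n.+1) => z z0; field; by rewrite z0 a1 C1.
Qed.

Let L : R := (c2 * gamma)^-1 + 15.

Let L_ge0 : 0 <= L.
Proof.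
case/andP: gamma01 => g0 _; have : 0 <= (c2 * gamma)^-1 by rewrite invr_ge0 mulr_ge0// ltW.
rewrite /L; lra.
Qed.

(** [15 = 8 + 7], from [(4 K)^(2K) <= expR (8 K^2)] and [8^K <= expR (7 K^2)]. *)
Let loss_ge n : expR (- (L * n.+1%:R ^+ 2)) <= c2 * std_floor n.+1 ^+ 2 / 8 ^+ n.+1.
Proof.
case/andP: gamma01 => g0 _; set K : R := n.+1%:R.
have K1 : 1 <= K by rewrite ler1n.
have cg0 : 0 < c2 * gamma by rewrite mulr_gt0.
rewrite expRN -[leRHS]invrK lef_pV2 ?posrE ?expR_gt0 ?invr_gt0//; last first.
  by apply: divr_gt0; [apply: mulr_gt0 => //; exact: (exprn_gt0 _ (std_floor_gt0 n)) | exact: exprn_gt0].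
have -> : (c2 * std_floor n.+1 ^+ 2 / 8 ^+ n.+1)^-1 = (c2 * gamma)^-1 * ((4 * K) ^+ n.+1 ^+ 2 * 8 ^+ n.+1).
  rewrite /std_floor expr_div_n sqr_sqrtr ?ltW// -/K; field.
  rewrite !expf_neq0 ?gt_eqF//; lra.
have K40 : 0 <= 4 * K by rewrite mulr_ge0.
have h1 : (c2 * gamma)^-1 <= expR ((c2 * gamma)^-1) by have := expR_ge1Dx (c2 * gamma)^-1; lra.
have h2 : 4 * K <= expR (4 * K) by have := expR_ge1Dx (4 * K); lra.
have h3 : 8 <= expR 7 :> R by have := expR_ge1Dx (7 : R); lra.
apply: (@le_trans _ _ (expR (c2 * gamma)^-1 * (expR (4 * K) ^+ n.+1 ^+ 2 * expR 7 ^+ n.+1))).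
  apply: ler_pM => //.
  - by rewrite invr_ge0 ltW.
  - by rewrite mulr_ge0 ?sqr_ge0 ?exprn_ge0.
  - apply: ler_pM; rewrite ?sqr_ge0 ?exprn_ge0//.
      by rewrite lerXn2r ?nnegrE ?exprn_ge0 ?expR_ge0// lerXn2r ?nnegrE ?expR_ge0.
    by rewrite lerXn2r ?nnegrE ?expR_ge0.
rewrite -!expRM_natl -/K -!expRD ler_expR /L.
have i0 : 0 <= (c2 * gamma)^-1 by rewrite invr_ge0 ltW.
nra.
Qed.

(** If some earlier node is closer to [0] than the new one, the product is below it
already.  Otherwise all distances from the new point to the earlier nodes are at
most twice those nodes, and one factor [r n] of the lower bound cancels. *)
Let next_ge n : r n * expR (- (L * n.+1%:R ^+ 2)) <= `|x n.+2|.
Proof.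
have [[k xk]|far] := pselect (exists k : 'I_n, `|x k.+2| <= `|x n.+2|).
  apply: le_trans xk; apply: le_trans (r_le k).
  by rewrite ler_piMr // -[leRHS]expR0 ler_expR oppr_le0; apply: mulr_ge0; [exact: L_ge0 | exact: sqr_ge0].
have rp := r_gt0 (@trajectory_distinct n).
have a0 := amax_ge0.
have W : node_dist n.+1 (x n.+2) <= `|x n.+2| * (2 ^+ n * r n).
  apply: node_dist_le_far => j; rewrite leNgt; apply/negP => xk; apply: far.
  by exists j; exact: ltW.
rewrite -(ler_pM2l rp) mulrA -expr2.
apply: le_trans (ler_wpM2l (sqr_ge0 _) (loss_ge n)) _.
apply: le_trans (improvement_lower n) _.
rewrite ler_pdivrMr; last by rewrite !mulr_gt0 ?exprn_gt0//; lra.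
apply: le_trans (improvement_le (@trajectory_distinct n)) _.
apply: le_trans (_ : 2 * (alpha n.+1 * (`|x n.+2| * (2 ^+ n * r n))) <= _).
  by rewrite ler_wpM2l// ler_wpM2l.
rewrite [leRHS](_ : _ = 2 * ((amax + 1) * (`|x n.+2| * (2 ^+ n.+1 * r n)))); last by ring.
rewrite ler_wpM2l//; apply: ler_pM; rewrite ?mulr_ge0 ?exprn_ge0//.
  by have := alpha_le (ltn0Sn n); lra.
rewrite ler_wpM2l// ler_wpM2r// ler_weXn2l//; lra.
Qed.

(** The logarithmic recursion is [s_(K+1) <= 2 s_K + L K^2]; the polynomial
[p(K) = K^2 + 2K + 3] is chosen so that [2 p(K) - K^2 = p(K+1)], and [3 * 2^K]
starts at [p(1) = 6]. *)
Let r_lower n : expR (- (L * (3 * 2 ^+ n.+1 - (n.+1%:R ^+ 2 + 2 * n.+1%:R + 3)))) <= r n.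
Proof.
elim: n => [|n IH].
  rewrite /r big_ord0 -[leRHS]expR0 ler_expR oppr_le0 mulr_ge0 ?L_ge0//; lra.
rewrite rS.
apply: le_trans (ler_wpM2l (r_ge0 n) (next_ge n)); rewrite [leRHS]mulrA -expr2.
apply: le_trans (ler_wpM2r (expR_ge0 _) (_ : expR _ ^+ 2 <= r n ^+ 2)); last first.
  by rewrite lerXn2r ?nnegrE ?expR_ge0//; exact: IH.
rewrite -expRM_natl -expRD ler_expR.
rewrite le_eqVlt; apply/orP; left; apply/eqP.
by rewrite [2 ^+ n.+2]exprS -[n.+2%:R]natr1; ring.
Qed.

Lemma trajectory_ge : exists2 D : R, 0 <= D & forall n, expR (- (D * 2 ^+ n.+1)) <= `|x n.+2|.
Proof.
exists (6 * L); first by have := L_ge0; lra.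
move=> n; apply: le_trans (_ : r n.+1 <= _); last first.
  by rewrite rS ler_piMl// r_le1.
apply: le_trans (r_lower n.+1); rewrite ler_expR lerN2 [2 ^+ n.+2]exprS.
have L0 := L_ge0; set z := 2 ^+ n.+1; set K : R := n.+2%:R.
have : 0 <= L * (K ^+ 2 + 2 * K + 3) by rewrite mulr_ge0// !addr_ge0 ?sqr_ge0 ?mulr_ge0.
lra.
Qed.

(** The improvement at the new point carries the factor [expR (- d^2 / (4 s^2))], which
cannot be smaller than [expR (- 6 L 2^K)]. *)
Lemma trajectory_le : exists2 C : R, 0 <= C &
  forall n, x n.+2 ^+ 2 <= C * 8 ^+ n.+1 * alpha n.+1 ^+ 2.
Proof.
exists (24 * L / cd ^+ 2); first by rewrite divr_ge0 ?sqr_ge0// mulr_ge0// L_ge0.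
move=> n; have dn := @trajectory_distinct n; have a0 := amax_ge0.
set K := n.+1; set y := x n.+2; set s := Num.sqrt (V K y).
have Ip := improvement_gt0 dn; rewrite -/K -/y in Ip.
have Iu := I_le (ltn0Sn n) dn (x_dom n.+1); rewrite -/K -/y -/s in Iu.
have s0 : 0 < s.
  rewrite lt_neqAle sqrtr_ge0 andbT eq_sym; apply/eqP => s0.
  by move: Iu; rewrite s0 mulr0 mul0r leNgt Ip.
have s_le : s <= alpha K * (`|y| * 2 ^+ n).
  apply: le_trans (V_le (ltn0Sn n) dn (x_dom n.+1)) _.
  by rewrite ler_wpM2l// node_dist_le.
have s_le' : s <= (amax + 1) * 2 ^+ K.
  apply: le_trans s_le _; apply: ler_pM; rewrite ?mulr_ge0 ?exprn_ge0//.
    by have := alpha_le (ltn0Sn n); lra.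
  apply: le_trans (_ : 2 ^+ n <= _); last by rewrite ler_weXn2l//; lra.
  by rewrite ler_piMl ?exprn_ge0 ?x_dom.
set z := d y ^+ 2 / (4 * s ^+ 2).
have zle : z <= 6 * L * 2 ^+ K.
  rewrite -lerN2 -ler_expR.
  apply: le_trans (_ : r n ^+ 2 * expR (- (L * K%:R ^+ 2)) <= _).
    apply: le_trans (ler_wpM2r (expR_ge0 _) (_ : expR _ ^+ 2 <= r n ^+ 2)); last first.
      by rewrite lerXn2r ?nnegrE ?expR_ge0//; exact: r_lower.
    rewrite -expRM_natl -expRD ler_expR -/K; have L0 := L_ge0.
    set w := 2 ^+ K; set k : R := K%:R.
    have : 0 <= L * (k ^+ 2 + 4 * k + 6) by rewrite mulr_ge0// !addr_ge0 ?sqr_ge0 ?mulr_ge0.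
    lra.
  apply: le_trans (ler_wpM2l (sqr_ge0 _) (loss_ge n)) _.
  apply: le_trans (improvement_lower n) _.
  rewrite ler_pdivrMr; last by rewrite !mulr_gt0 ?exprn_gt0//; lra.
  apply: le_trans Iu _; rewrite mulNr -/z [leRHS]mulrC ler_wpM2r ?expR_ge0//.
  by rewrite -mulrA ler_wpM2l.
have dy : cd * y ^+ 2 <= d y by apply: d_ge; exact: x_dom.
have zge : cd ^+ 2 * y ^+ 2 <= z * (4 * (alpha K * 2 ^+ n) ^+ 2).
  set B := alpha K * 2 ^+ n; have B0 : 0 <= B by rewrite mulr_ge0 ?exprn_ge0.
  have sB : s <= B * `|y| by rewrite /B mulrAC -mulrA.
  have s2 : s ^+ 2 <= B ^+ 2 * y ^+ 2.
    rewrite -[y ^+ 2]real_normK ?num_real// -exprMn lerXn2r ?nnegrE ?mulr_ge0//.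
    exact: ltW.
  have d2 : (cd * y ^+ 2) ^+ 2 <= d y ^+ 2.
    have h : 0 <= cd * y ^+ 2 by rewrite mulr_ge0 ?sqr_ge0 ?ltW.
    by rewrite lerXn2r ?nnegrE// (le_trans h).
  have -> : z * (4 * B ^+ 2) = d y ^+ 2 * B ^+ 2 / s ^+ 2.
    by rewrite /z; field; rewrite gt_eqF.
  rewrite ler_pdivlMr ?exprn_gt0//.
  apply: le_trans (ler_wpM2l _ s2) _; first by rewrite mulr_ge0 ?sqr_ge0.
  rewrite [leLHS](_ : _ = (cd * y ^+ 2) ^+ 2 * B ^+ 2); last by ring.
  by rewrite ler_wpM2r ?sqr_ge0.
have cd2 : 0 < cd ^+ 2 by rewrite exprn_gt0.
rewrite -(ler_pM2l cd2); apply: le_trans zge _.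
rewrite [leRHS](_ : _ = 6 * L * 2 ^+ K * (4 * (alpha K * 2 ^+ K) ^+ 2)); last first.
  have -> : 8 ^+ K = 2 ^+ K * 2 ^+ K * 2 ^+ K :> R.
    by rewrite -!exprMn; congr (_ ^+ _); ring.
  by field; rewrite gt_eqF.
apply: ler_pM => //.
- by apply: divr_ge0; [exact: sqr_ge0 | apply: mulr_ge0 => //; exact: sqr_ge0].
- by apply: mulr_ge0 => //; exact: sqr_ge0.
rewrite ler_wpM2l// lerXn2r ?nnegrE ?mulr_ge0 ?exprn_ge0//.
by rewrite ler_wpM2l// ler_weXn2l//; lra.
Qed.

End Dynamics.

(** * The spectral density, the conditional mean and density of the orbit *)

Section Assembly.
Context {R : realType}.
Local Notation mu := (@lebesgue_measure R).

(** The value of the spectral density at the origin is arbitrary and may be negative;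
it can be replaced by [gamma] without affecting any integral. *)
Lemma positive_density (G Ghat S : R -> R) :
  has_spectral_density G Ghat -> (forall t, t != 0 -> Ghat t = expR (- S `|t|)) ->
  (forall t : R, 0 < t -> t <= 1 -> S t <= S 1) ->
  exists (g : R -> R) (gamma : R), [/\ 0 < gamma <= 1,
    forall t, 0 <= g t /\ (`|t| <= 1 -> gamma <= g t),
    forall t, t != 0 -> g t = expR (- S `|t|),
    mu.-integrable setT (EFin \o g) &
    forall x, G x = \int[mu]_t (g t * cos (t * x))].
Proof.
move=> [Gi GE] hS S1; pose gamma := Num.min 1 (expR (- S 1)).
(* Written as a sum to be visibly measurable. *)
pose g t : R := Ghat t + (gamma - Ghat 0) * \1_(`[0, 0]%classic) t.
have g0 : g 0 = gamma.
  by rewrite /g indicE mem_set ?mulr1 ?subrKC//= in_itv/= lexx.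
have gE t : t != 0 -> g t = Ghat t.
  move=> t0; rewrite /g indicE memNset ?mulr0 ?addr0//= in_itv/= => /andP[h1 h2].
  by move: t0; rewrite eq_le h1 h2.
have gS t : t != 0 -> g t = expR (- S `|t|) by move=> t0; rewrite gE// hS.
have gi : mu.-integrable setT (EFin \o g).
  have ii : mu.-integrable setT (EFin \o (\1_(`[0, 0]%classic) : R -> R)).
    exact: integrable_indic_itv.
  have iZ := integrableZl measurableT (gamma - Ghat 0) ii.
  have iD := integrableD measurableT Gi iZ.
  exact: iD.
have gamma0 : 0 < gamma by rewrite /gamma lt_min ltr01 expR_gt0.
have gam1 : gamma <= 1 by rewrite /gamma ge_min lexx.
exists g, gamma; split => //.
- by rewrite gamma0.
- move=> t; have [->|t0] := eqVneq t 0; first by rewrite g0; split => //; exact: ltW.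
  rewrite gS//; split; first exact: expR_ge0.
  move=> t1; rewrite /gamma ge_min ler_expR lerN2 S1 ?orbT// normr_gt0//.
- move=> x; rewrite (GE x).1; congr fine.
  have mc : measurable_fun setT (fun t : R => cos (t * x)).
    apply: (measurableT_comp (f := cos)) => //.
      by apply: continuous_measurable_fun; exact: continuous_cos.
    exact: measurable_funM.
  have mG (h : R -> R) : mu.-integrable setT (EFin \o h) ->
      measurable_fun (setT `\ (0 : R)) (fun t => (h t * cos (t * x))%:E).
    move=> hi; apply/measurable_EFinP; apply: measurable_funTS.
    by apply: measurable_funM => //; apply/measurable_EFinP; exact: measurable_int hi.
  rewrite -(@integral_setD1 _ _ 0); last 2 first.
  - exact: measurableD.
  - exact: mG.
  rewrite -[RHS](@integral_setD1 _ _ 0); last 2 first.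
  - exact: measurableD.
  - exact: mG.
  by apply: eq_integral => t; rewrite inE/= => -[_ /eqP t0]; rewrite gE.
Qed.

(** All but finitely many points lie in [[-1/2, 1/2]], and a finite set cannot
contain the interval that remains. *)
Lemma cvg0_not_dense (u : nat -> R) (D : set nat) : u k @[k --> \oo] --> 0 ->
  ~ (`[-1, 1] `<=` closure (u @` D)).
Proof.
move=> u0 dense.
have /cvgr0Pnorm_lt/(_ 2^-1) := u0; rewrite invr_gt0 => /(_ ltac:(by []))[N _ uN].
pose F : set R := u @` `I_N.
have finF : finite_set F by apply: finite_image; exact: finite_II.
have clF : closed F.
  by move: F finF; apply/accessible_finite_set_closed/hausdorff_accessible.
have sub : closure (u @` D) `<=` F `|` `[- 2^-1, 2^-1].
  rewrite closureE; apply: smallest_sub.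
  apply: closedU; last exact: interval_closed.
    exact: clF.
  move=> _ [k _ <-]; have [kN|Nk] := ltnP k N; first by left; exists k.
  by right; rewrite /= in_itv/= -ler_norml; apply/ltW/uN.
have subF : [set` `]2^-1, (1 : R)]] `<=` F.
  move=> y /=; rewrite in_itv/= => /andP[y1 y2].
  have /dense/sub[//|] : `[-1, 1]%classic y by rewrite /= in_itv/=; apply/andP; split; lra.
  by rewrite /= in_itv/=; lra.
have : (mu [set` `]2^-1, 1%R]%R] <= mu F)%E.
  apply: le_measure => //; rewrite inE.
    exact: measurable_itv.
  exact: closed_measurable.
rewrite [X in (_ <= X)%E]countable_lebesgue_measure0; last exact: finite_set_countable.
rewrite lebesgue_measure_itv/= lte_fin ifT; last lra.
rewrite -EFinD lee_fin; lra.
Qed.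

Lemma expn_le_fact K : (0 < K)%N -> K%:R ^+ K <= expR K%:R * K`!%:R :> R.
Proof.
case: K => // n _; have := @expR_ge1Dxn R n.+1%:R n (ler0n _ _).
rewrite -ler_pdivrMr ?ltr0n ?fact_gt0//; lra.
Qed.

(** The observed values are minus the first column of the Gram matrix. *)
Lemma cond_meanE (G f : R -> R) (x : nat -> R) (K : nat) (y : R) : (0 < K)%N ->
  gram G x K \in unitmx -> x 1%N = 0 -> (forall k, f (x k.+1) = - G (x k.+1)) ->
  cond_mean G f x K y = - G y.
Proof.
case: K => // n _ Au x1 fE; rewrite /cond_mean.
have -> : value_vec f x n.+1 = - (gram G x n.+1 *m delta_mx ord0 0).
  by rewrite -colE; apply/colP => k; rewrite !mxE fE x1 subr0.
by rewrite mulmxN mulmxA mulmxKV// -colE !mxE x1 subr0.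
Qed.

Lemma best_valueE (G f : R -> R) (x : nat -> R) (K : nat) : (0 < K)%N ->
  x 1%N = 0 -> (forall k, f (x k.+1) = - G (x k.+1)) ->
  (forall k, G (x k.+1) <= G 0) -> best_value f x K = - G 0.
Proof.
move=> K0 x1 fE Gle; have f1 : f (x 1%N) = - G 0 by rewrite fE x1.
rewrite /best_value f1; elim/big_rec: _ => // k v _ ->.
by apply/min_idPr; rewrite fE lerN2.
Qed.

End Assembly.

(** * Bounds on the trajectory *)

Section TrajectoryBounds.
Context {R : realType}.
Local Notation mu := (@lebesgue_measure R).
Variables (G g f : R -> R) (gamma amax : R) (x : nat -> R).
Hypothesis g_ge0 : forall t, 0 <= g t.
Hypothesis g_int : mu.-integrable setT (EFin \o g).
Hypothesis GE : forall x, G x = \int[mu]_t (g t * cos (t * x)).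
Hypothesis gamma01 : 0 < gamma <= 1.
Hypothesis g_ge : forall t, `|t| <= 1 -> gamma <= g t.
Hypothesis moment_int : forall K, (0 < K)%N ->
  mu.-integrable setT (EFin \o (fun t => g t * t ^+ K.*2)).

(** The factor of [node_dist] in the upper bound for the standard deviation. *)
Definition interpolation_rate (K : nat) : R :=
  Num.sqrt (2 * \int[mu]_t (g t * t ^+ K.*2)) / K`!%:R.

Hypothesis rate_le : forall K, (0 < K)%N -> interpolation_rate K <= amax.
Hypothesis hf : forall y, y \in `[-1, 1] -> f y = - G y.
Hypothesis x_traj : EI_trajectory G f x.
Hypothesis x1 : x 1%N = 0.

Let gamma_gt0 : 0 < gamma. Proof. by case/andP: gamma01. Qed.

Let x_dom k : `|x k.+1| <= 1.
Proof.
case: x_traj => x1d traj; suff : x k.+1 \in `[-1, 1] by rewrite in_itv/= -ler_norml.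
by case: k => [|k] //; have [] := traj k.+1 (ltn0Sn k).
Qed.

Let rate_ge0 K : 0 <= interpolation_rate K.
Proof. by rewrite divr_ge0 ?sqrtr_ge0. Qed.

Let node_dist_ge0 K y : 0 <= node_dist x K y.
Proof. exact: prodr_ge0. Qed.

Let node_dist_sqr K y : node_dist x K y ^+ 2 = \prod_(k < K) (y - x k.+1) ^+ 2.
Proof.
by rewrite /node_dist -prodrXl; apply: eq_bigr => k _; rewrite real_normK ?num_real.
Qed.

Let moment_ge0 K : 0 <= \int[mu]_t (g t * t ^+ K.*2).
Proof.
by apply: Rintegral_ge0 => t _; rewrite mulr_ge0// -muln2 mulnC exprM exprn_ge0// sqr_ge0.
Qed.

Let std_ge K y : (0 < K)%N -> nodes_distinct x K -> `|y| <= 1 ->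
  std_floor gamma K * node_dist x K y <= Num.sqrt (cond_var G x K y).
Proof.
move=> K0 dK y1.
have b0 : 0 <= std_floor gamma K by rewrite divr_ge0 ?sqrtr_ge0// exprn_ge0// mulr_ge0.
rewrite -[leLHS]ger0_norm ?mulr_ge0// -sqrtr_sqr ler_wsqrtr//.
apply: le_trans (cond_var_ge g_ge0 g_int GE gamma_gt0 g_ge dK (fun k => x_dom k) y1).
rewrite exprMn node_dist_sqr /std_floor expr_div_n sqr_sqrtr ?(ltW gamma_gt0)//.
by rewrite -exprM muln2 -mul2n mulrAC.
Qed.

Let std_le K y : (0 < K)%N -> nodes_distinct x K -> `|y| <= 1 ->
  Num.sqrt (cond_var G x K y) <= interpolation_rate K * node_dist x K y.
Proof.
move=> K0 dK y1.
rewrite -[leRHS]ger0_norm ?mulr_ge0// -sqrtr_sqr ler_wsqrtr//.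
apply: le_trans (cond_var_le g_ge0 g_int GE gamma_gt0 g_ge dK (fun k => x_dom k) y (moment_int K0)) _.
rewrite exprMn node_dist_sqr /interpolation_rate expr_div_n sqr_sqrtr ?mulr_ge0//.
by rewrite le_eqVlt; apply/orP; left; apply/eqP; ring.
Qed.

Let m1_int : mu.-integrable setT (EFin \o (fun t => g t * t ^+ 2)).
Proof. exact: (moment_int (ltn0Sn 0)). Qed.

Let drop_ge y : `|y| <= 1 -> gamma / 32 * y ^+ 2 <= G 0 - G y.
Proof. by move=> y1; apply: (kernel_drop_ge g_ge0 g_int GE (ltW gamma_gt0) y1). Qed.

Let drop_ge0 y : `|y| <= 1 -> 0 <= G 0 - G y.
Proof.
move=> /drop_ge; apply: le_trans; rewrite mulr_ge0 ?sqr_ge0// divr_ge0//; exact: ltW.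
Qed.

Let node_f k : f (x k.+1) = - G (x k.+1).
Proof. by apply: hf; rewrite in_itv/= -ler_norml. Qed.

Let improvementE K y : (0 < K)%N -> nodes_distinct x K ->
  expected_improvement G f x K y =
  \int[gauss_law (- G y) (cond_var G x K y)]_z
    (- G y - (G 0 - G y) - Num.min (- G y - (G 0 - G y)) z).
Proof.
move=> K0 dK; rewrite /expected_improvement cond_meanE//; last first.
  exact: (gram_unit g_ge0 g_int GE gamma_gt0 g_ge dK (fun k => x_dom k)).
rewrite (@best_valueE _ G)//; last by move=> k; rewrite -subr_ge0; exact: drop_ge0.
by have -> : - G y - (G 0 - G y) = - G 0 by ring.
Qed.

Lemma EI_trajectory_bounds :
  (exists2 D : R, 0 <= D & forall n, expR (- (D * 2 ^+ n.+1)) <= `|x n.+2|) /\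
  (exists2 C : R, 0 <= C &
     forall n, x n.+2 ^+ 2 <= C * 8 ^+ n.+1 * interpolation_rate n.+1 ^+ 2).
Proof.
have V0 K y : nodes_distinct x K -> 0 <= cond_var G x K y.
  by move=> dK; exact: (cond_var_ge0 g_ge0 g_int GE gamma_gt0 g_ge dK (fun k => x_dom k)).
have I_ge K y : (0 < K)%N -> nodes_distinct x K -> `|y| <= 1 ->
    0 < Num.sqrt (cond_var G x K y) -> G 0 - G y <= Num.sqrt (cond_var G x K y) ->
    small_gap_const * Num.sqrt (cond_var G x K y) <= expected_improvement G f x K y.
  move=> K0 dK y1; rewrite sqrtr_gt0 => s0 ds; rewrite improvementE//.
  by apply: gauss_improvement_ge => //; exact: drop_ge0.
have I_le K y : (0 < K)%N -> nodes_distinct x K -> `|y| <= 1 ->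
    expected_improvement G f x K y <= 2 * Num.sqrt (cond_var G x K y) *
    expR (- (G 0 - G y) ^+ 2 / (4 * Num.sqrt (cond_var G x K y) ^+ 2)).
  move=> K0 dK y1; rewrite improvementE// sqr_sqrtr ?V0//.
  by apply: gauss_improvement_le; [exact: V0 | exact: drop_ge0].
have I_max K y : (0 < K)%N -> `|y| <= 1 ->
    expected_improvement G f x K y <= expected_improvement G f x K (x K.+1).
  move=> K0 y1; case: x_traj => _ /(_ _ K0)[_]; apply.
  by rewrite in_itv/= -ler_norml.
have cd0 : 0 < gamma / 32 by rewrite divr_gt0.
have Cd0 : 0 <= \int[mu]_t (g t * t ^+ 2) / 2 by rewrite divr_ge0 ?(moment_ge0 1).
have drop_le y : `|y| <= 1 -> G 0 - G y <= \int[mu]_t (g t * t ^+ 2) / 2 * y ^+ 2.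
  by move=> _; exact: kernel_drop_le.
split.
  by apply: (trajectory_ge gamma01 Cd0 (@small_gap_const_gt0 R) rate_ge0 rate_le x1 x_dom
    std_ge std_le drop_le I_ge I_le I_max).
by apply: (trajectory_le gamma01 cd0 Cd0 (@small_gap_const_gt0 R) rate_ge0 rate_le x1 x_dom
    std_ge std_le drop_ge drop_le I_ge I_le I_max).
Qed.

End TrajectoryBounds.

(** [K^(2K+1)], which the rate contains, is at most [expR (3 K) K!^2]. *)
Lemma interpolation_rate_le (R : realType) (g T : R -> R) (K : nat) : (0 < K)%N ->
  \int[@lebesgue_measure R]_t (g t * t ^+ K.*2) <=
    2 * expR 1 * expR (legendre T (2 * K + 1)%:R) ->
  (forall t, 0 <= g t) ->
  interpolation_rate g K ^+ 2 <= 4 * expR 1 * expR (EI_rate T K + 3 * K%:R).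
Proof.
move=> K0; set m := Rintegral _ _ _ => mle g0.
have m0 : 0 <= m.
  by apply: Rintegral_ge0 => t _; rewrite mulr_ge0// -muln2 mulnC exprM exprn_ge0// sqr_ge0.
have k0 : 0 < K%:R :> R by rewrite ltr0n.
have f0 : 0 < K`!%:R :> R by rewrite ltr0n fact_gt0.
rewrite /interpolation_rate -/m expr_div_n sqr_sqrtr ?mulr_ge0//.
rewrite ler_pdivrMr ?exprn_gt0//.
have E : expR (legendre T (2 * K + 1)%:R) = expR (EI_rate T K) * (K%:R * (K%:R ^+ K) ^+ 2).
  have -> : K%:R * (K%:R ^+ K) ^+ 2 = K%:R ^+ (2 * K + 1) :> R.
    by rewrite addn1 [RHS]exprS -exprM mulnC.
  have -> : K%:R ^+ (2 * K + 1) = expR ((2 * K + 1)%:R * ln K%:R) :> R.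
    by rewrite expRM_natl lnK// posrE.
  by rewrite -expRD /EI_rate subrK.
have kk : K%:R * (K%:R ^+ K) ^+ 2 <= expR (3 * K%:R) * K`!%:R ^+ 2 :> R.
  have -> : expR (3 * K%:R) * K`!%:R ^+ 2 = expR K%:R * (expR K%:R * K`!%:R) ^+ 2 :> R.
    by rewrite (expRM_natl 3); ring.
  apply: ler_pM => //; rewrite ?sqr_ge0//.
    by have := expR_ge1Dx (K%:R : R); lra.
  by rewrite lerXn2r ?nnegrE ?exprn_ge0 ?mulr_ge0 ?expR_ge0// expn_le_fact.
apply: le_trans (_ : 2 * (2 * expR 1 * expR (legendre T (2 * K + 1)%:R)) <= _).
  by rewrite ler_wpM2l.
rewrite E expRD.
rewrite [leLHS](_ : _ = 4 * expR 1 * expR (EI_rate T K) * (K%:R * (K%:R ^+ K) ^+ 2)); last by ring.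
rewrite [leRHS](_ : _ = 4 * expR 1 * expR (EI_rate T K) * (expR (3 * K%:R) * K`!%:R ^+ 2)); last by ring.
by rewrite ler_wpM2l// !mulr_ge0 ?expR_ge0.
Qed.

Theorem theorem3 (R : realType) (G Ghat S T f : R -> R) (x : nat -> R)
  (hG : stationary_gaussian_covariance `[-1, 1] G)
  (hGhat : has_spectral_density G Ghat)
  (hS : forall t, t != 0 -> Ghat t = expR (- S `|t|))
  (hT : forall t, t != 0 -> Ghat t = expR (- T (ln `|t|)))
  (S_C2 : C2_on `]0, +oo[ S)
  (T_C2 : C2_on [set: R] T)
  (S'_ge0 : forall t, 0 < t -> 0 <= S^`()%classic t)
  (S''_ge0 : forall t, 0 < t -> 0 <= S^`(2)%classic t)
  (S'_cvgy : S^`()%classic t @[t --> +oo] --> +oo)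
  (hf : forall y, y \in `[-1, 1] -> f y = - G y)
  (x_traj : EI_trajectory G f x)
  (x1 : x 1%N = 0) :
  [/\ x k @[k --> \oo] --> 0,
      ~ (`[-1, 1] `<=` closure (x @` [set k | (0 < k)%N])),
      \forall q \near +oo, legendre_attained T q
    & \forall K \near \oo,
        expR (2 ^+ K * EI_rate T K) <= `|x K.+1| <= expR (EI_rate T K / 3)].
Proof.
have TS s : T s = S (expR s).
  have e0 : expR s != 0 by rewrite gt_eqF ?expR_gt0.
  have := hT _ e0; rewrite hS// ger0_norm ?expR_ge0// expRK => /expR_inj/oppr_inj.
  by [].
have T_cont : continuous T.
  move=> s; have [+ _ _] := T_C2 s I.
  by move=> /derivable1_diffP/differentiable_continuous.
have S1 (t : R) : 0 < t -> t <= 1 -> S t <= S 1.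
  move=> t0 t1; apply: le_trans (exponent_ge_tangent S_C2 S''_ge0 t0 ltr01).
  by rewrite lerDl mulr_ge0 ?subr_ge0 ?S'_ge0.
have [g [gamma [gamma01 g_bounds gS g_int GE]]] := positive_density hGhat hS S1.
have g_ge0 t : 0 <= g t by have [] := g_bounds t.
have g_ge t : `|t| <= 1 -> gamma <= g t by have [] := g_bounds t.
have g_meas : measurable_fun setT g by apply/measurable_EFinP; exact: measurable_int g_int.
have moment K : (0 < K)%N ->
    (@lebesgue_measure R).-integrable setT (EFin \o (fun t => g t * t ^+ K.*2)) /\
    \int[@lebesgue_measure R]_t (g t * t ^+ K.*2) <=
      2 * expR 1 * expR (legendre T (2 * K + 1)%:R).
  move=> K0; have [tau tau0 tauP] := moment_integrand_le S_C2 S''_ge0 S'_cvgy TS T_cont K.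
  apply: (moment_le tau0 (expR_ge0 _)) => // t.
  have [->|t0] := eqVneq t 0.
    by rewrite expr0n double_eq0 gtn_eqF// mulr0 mulr_ge0 ?divr_ge0 ?expR_ge0 ?(ltW tau0).
  have := tauP `|t|; rewrite normr_gt0 => /(_ t0); rewrite gS// mulrC.
  by rewrite exprM real_normK ?num_real// -exprM mul2n.
have rate2 K : (0 < K)%N ->
    interpolation_rate g K ^+ 2 <= 4 * expR 1 * expR (EI_rate T K + 3 * K%:R).
  by move=> K0; apply: interpolation_rate_le => //; have [] := moment _ K0.
have rate_max : exists amax : R, forall K, (0 < K)%N -> interpolation_rate g K <= amax.
  have [c cP] := EI_rate_superlinear S_C2 S''_ge0 S'_cvgy TS T_cont (ler0n R 3).
  exists (1 + 4 * expR 1 * expR c) => K K0.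
  have : interpolation_rate g K ^+ 2 <= 4 * expR 1 * expR c.
    apply: le_trans (rate2 _ K0) _; rewrite ler_wpM2l ?mulr_ge0 ?expR_ge0// ler_expR.
    have := cP _ K0; lra.
  move: (4 * _ * _) (interpolation_rate g K) => b a ab.
  have := sqr_ge0 (a - 1 / 2); rewrite sqrrB; lra.
have [amax rate_le] := rate_max.
have [[D D0 lower] [C C0 upper]] := EI_trajectory_bounds g_ge0 g_int GE gamma01 g_ge
  (fun K K0 => (moment K K0).1) rate_le hf x_traj x1.
have rate_linear (B b : R) : 0 <= B -> \forall K \near \oo, EI_rate T K <= b - B * K%:R.
  move=> B0; have B1 : 0 <= B + 1 by lra.
  have [c cP] := EI_rate_superlinear S_C2 S''_ge0 S'_cvgy TS T_cont B1.
  near=> K; have K0 : (0 < K)%N by near: K; exact: nbhs_infty_gt.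
  have cK : c - b <= K%:R by near: K; exact: nbhs_infty_ger.
  by have := cP _ K0; lra.
have main : \forall K \near \oo,
    expR (2 ^+ K * EI_rate T K) <= `|x K.+1| <= expR (EI_rate T K / 3).
  (* [C' * 8^K * expR (3 K) <= expR (C' + 10 K)], and a third of the rate must absorb it. *)
  pose C' := C * (4 * expR 1).
  have C'0 : 0 <= C' by rewrite !mulr_ge0 ?expR_ge0.
  near=> K; have K0 : (0 < K)%N by near: K; exact: nbhs_infty_gt.
  have F1 : EI_rate T K <= - D - 0 * K%:R by near: K; exact: rate_linear.
  have F2 : EI_rate T K <= - (3 * C') - 30 * K%:R by near: K; exact: rate_linear.
  have KE : K = K.-1.+1 by rewrite prednK.
  apply/andP; split.
    have := lower K.-1; rewrite -KE; apply: le_trans; rewrite ler_expR.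
    rewrite -mulNr mulrC ler_wpM2r ?exprn_ge0//; lra.
  rewrite -(@ler_pXn2r _ 2) ?nnegrE ?expR_ge0// real_normK ?num_real//.
  have := upper K.-1; rewrite -KE => /le_trans; apply.
  apply: le_trans (ler_wpM2l _ (rate2 _ K0)) _; first by rewrite mulr_ge0 ?exprn_ge0.
  rewrite [leLHS](_ : _ = C' * 8 ^+ K * expR (EI_rate T K + 3 * K%:R)); last first.
    by rewrite /C'; ring.
  have h3 : 8 <= expR 7 :> R by have := expR_ge1Dx (7 : R); lra.
  have hC : C' <= expR C' by have := expR_ge1Dx C'; lra.
  apply: (@le_trans _ _ (expR C' * expR 7 ^+ K * expR (EI_rate T K + 3 * K%:R))).
    rewrite ler_wpM2r ?expR_ge0//; apply: ler_pM; rewrite ?exprn_ge0//.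
    by rewrite lerXn2r ?nnegrE ?expR_ge0.
  rewrite -!expRM_natl -!expRD ler_expR; lra.
have x_cvg : x k @[k --> \oo] --> 0.
  rewrite -cvg_shiftS; apply/cvgr0Pnorm_le => e e0; near=> K.
  have /andP[_] : expR (2 ^+ K * EI_rate T K) <= `|x K.+1| <= expR (EI_rate T K / 3).
    by near: K.
  move=> /le_trans; apply.
  have : EI_rate T K <= 3 * ln e - 0 * K%:R by near: K; exact: rate_linear.
  by move=> F; rewrite -[leRHS]lnK ?posrE// ler_expR; lra.
split => //.
- exact: cvg0_not_dense.
- near=> q; apply: (legendre_attained_of_pos S_C2 S''_ge0 S'_cvgy TS T_cont).
  by near: q; exact: nbhs_pinfty_gt.
Unshelve. all: by end_near. Qed.
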